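(* Let $G\subset\mathbb{R}^3$ be a simply connected domain, let $p,q$ be complex valued functions on $G$ with $p\in C^2(G)$ and $p\neq0$ in $G$, let $u_0$ be a nonvanishing particular solution of $$(\operatorname{div}p\operatorname{grad}+q)u=0\qquad\text{in }G,\qquad(\ast)$$ and put $f=p^{1/2}u_0$. Let $\mathbf F$ be a (continuously differentiable, purely vectorial) solution of $$\left(D+M^{\frac{Df}{f}}\right)\mathbf F=0\qquad\text{in }G.$$ Then $u=u_0\,\mathcal A[f^{-1}\mathbf F]$ is a solution of $(\ast)$ in $G$.
   Context: $\mathbb{H}(\mathbb{C})$ is the algebra of complex quaternions $Q=Q_0+\mathbf Q$, $\mathbf Q=Q_1\mathbf i+Q_2\mathbf j+Q_3\mathbf k$, $Q_0,\dots,Q_3\in\mathbb{C}$, where $\mathbf i,\mathbf j,\mathbf k$ are the quaternionic imaginary units, commuting with the complex imaginary unit $i$. Purely vectorial complex quaternions ($Q_0=0$) are identified with vectors in $\mathbb{C}^3$; scalar means $\mathbf Q=0$. For differentiable $\mathbb{H}(\mathbb{C})$-valued $Q$ of $(x,y,z)$, $DQ=\mathbf i\,\partial_xQ+\mathbf j\,\partial_yQ+\mathbf k\,\partial_zQ$ (for scalar $f$, $Df$ is identified with $\operatorname{grad}f$). $M^PQ=Q\cdot P$ is multiplication by $P$ from the right. $(\operatorname{div}p\operatorname{grad}+q)u=\operatorname{div}(p\operatorname{grad}u)+qu$; solutions of this equation are complex valued and twice continuously differentiable. $p^{1/2}$ denotes one fixed twice continuously differentiable function on $G$ whose square is $p$.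 For a complex valued vector field $\mathbf E$ on a simply connected domain with $\operatorname{rot}\mathbf E\equiv0$, $\mathcal A[\mathbf E]$ denotes its antigradient: a complex valued scalar function $\varphi$ with $\operatorname{grad}\varphi=\mathbf E$, defined up to an arbitrary additive constant. Part of the assertion is that $f^{-1}\mathbf F$ has zero rot, so that $\mathcal A[f^{-1}\mathbf F]$ is defined; the conclusion holds for any choice of the constant. *)

(* Defs.v *)
From Stdlib Require Import Reals.
From Coquelicot Require Import Coquelicot.
Open Scope R_scope.

Definition R3 : Type := (R * R * R)%type.

Definition unit_interval (t : R) : Prop := 0 <= t <= 1.
Definition unit_square (st : R * R) : Prop :=
  unit_interval (fst st) /\ unit_interval (snd st).

Definition path_in (G : R3 -> Prop) (c : R -> R3) : Prop :=
  continuous_on unit_interval c /\ (forall t, unit_interval t -> G (c t)).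

Definition path_connected (G : R3 -> Prop) : Prop :=
  forall A B : R3, G A -> G B ->
  exists c : R -> R3, path_in G c /\ c 0 = A /\ c 1 = B.

(* Homotopy relative to the base point [c 0]. *)
Definition null_homotopic (G : R3 -> Prop) (c : R -> R3) : Prop :=
  exists H : R * R -> R3,
    continuous_on unit_square H /\
    (forall st, unit_square st -> G (H st)) /\
    (forall t, unit_interval t -> H (0, t) = c t) /\
    (forall t, unit_interval t -> H (1, t) = c 0) /\
    (forall s, unit_interval s -> H (s, 0) = c 0 /\ H (s, 1) = c 0).

Definition simply_connected (G : R3 -> Prop) : Prop :=
  path_connected G /\
  (forall c : R -> R3, path_in G c -> c 0 = c 1 -> null_homotopic G c).

(* Connectedness of the domain is part of [simply_connected]. *)
Definition simply_connected_domain (G : R3 -> Prop) : Prop :=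
  open G /\ (exists P, G P) /\ simply_connected G.

(* Functions on [G] are represented by total functions on [R3]; since [G] is
   open, nothing below depends on their values outside [G]. *)

Inductive axis : Set := axX | axY | axZ.

Definition coord (k : axis) (P : R3) : R :=
  let '(x, y, z) := P in match k with axX => x | axY => y | axZ => z end.

Definition set_coord (k : axis) (P : R3) (t : R) : R3 :=
  let '(x, y, z) := P in
  match k with axX => (t, y, z) | axY => (x, t, z) | axZ => (x, y, t) end.

Definition ex_pd (k : axis) (g : R3 -> C) (P : R3) : Prop :=
  ex_derive (fun t : R => g (set_coord k P t)) (coord k P).

(* [Derive] is total, so [pd] is meaningful only where [ex_pd] holds. *)
Definition pd (k : axis) (g : R3 -> C) (P : R3) : C :=
  (Derive (fun t => Re (g (set_coord k P t))) (coord k P),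
   Derive (fun t => Im (g (set_coord k P t))) (coord k P)).

Fixpoint class_C (n : nat) (G : R3 -> Prop) (g : R3 -> C) : Prop :=
  (forall P, G P -> continuous g P) /\
  match n with
  | O => True
  | S m => forall k, (forall P, G P -> ex_pd k g P) /\ class_C m G (pd k g)
  end.

Record HC : Type := mkHC { q0 : C; q1 : C; q2 : C; q3 : C }.

Open Scope C_scope.

Definition Hzero : HC := mkHC 0 0 0 0.
Definition Hi : HC := mkHC 0 1 0 0.
Definition Hj : HC := mkHC 0 0 1 0.
Definition Hk : HC := mkHC 0 0 0 1.

Definition Hadd (A B : HC) : HC :=
  mkHC (q0 A + q0 B) (q1 A + q1 B) (q2 A + q2 B) (q3 A + q3 B).

Definition Hmul (A B : HC) : HC :=
  mkHC (q0 A * q0 B - q1 A * q1 B - q2 A * q2 B - q3 A * q3 B)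
       (q0 A * q1 B + q1 A * q0 B + q2 A * q3 B - q3 A * q2 B)
       (q0 A * q2 B - q1 A * q3 B + q2 A * q0 B + q3 A * q1 B)
       (q0 A * q3 B + q1 A * q2 B - q2 A * q1 B + q3 A * q0 B).

Definition Hscal (c : C) (A : HC) : HC :=
  mkHC (c * q0 A) (c * q1 A) (c * q2 A) (c * q3 A).

Definition scalar (c : C) : HC := mkHC c 0 0 0.

Definition vectorial (A : HC) : Prop := q0 A = 0.

Definition Hclass_C (n : nat) (G : R3 -> Prop) (Q : R3 -> HC) : Prop :=
  class_C n G (fun P => q0 (Q P)) /\ class_C n G (fun P => q1 (Q P)) /\
  class_C n G (fun P => q2 (Q P)) /\ class_C n G (fun P => q3 (Q P)).

Definition Hpd (k : axis) (Q : R3 -> HC) (P : R3) : HC :=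
  mkHC (pd k (fun P => q0 (Q P)) P) (pd k (fun P => q1 (Q P)) P)
       (pd k (fun P => q2 (Q P)) P) (pd k (fun P => q3 (Q P)) P).

Definition Dop (Q : R3 -> HC) (P : R3) : HC :=
  Hadd (Hmul Hi (Hpd axX Q P))
       (Hadd (Hmul Hj (Hpd axY Q P)) (Hmul Hk (Hpd axZ Q P))).

Definition Mright (A : HC) (Q : HC) : HC := Hmul Q A.

(* Vector fields are fields of purely vectorial quaternions:
   [div] and [rot] only look at the vector part. *)

Definition grad (g : R3 -> C) (P : R3) : HC :=
  mkHC 0 (pd axX g P) (pd axY g P) (pd axZ g P).

Definition div (E : R3 -> HC) (P : R3) : C :=
  pd axX (fun P => q1 (E P)) P + pd axY (fun P => q2 (E P)) P
  + pd axZ (fun P => q3 (E P)) P.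

Definition rot (E : R3 -> HC) (P : R3) : HC :=
  mkHC 0
    (pd axY (fun P => q3 (E P)) P - pd axZ (fun P => q2 (E P)) P)
    (pd axZ (fun P => q1 (E P)) P - pd axX (fun P => q3 (E P)) P)
    (pd axX (fun P => q2 (E P)) P - pd axY (fun P => q1 (E P)) P).

(* [phi] is one of the values of the multivalued operator A[E]. *)
Definition antigradient (G : R3 -> Prop) (E : R3 -> HC) (phi : R3 -> C) : Prop :=
  forall P, G P -> (forall k, ex_pd k phi P) /\ grad phi P = E P.

Definition solution (G : R3 -> Prop) (p q u : R3 -> C) : Prop :=
  class_C 2 G u /\
  (forall P, G P -> div (fun P => Hscal (p P) (grad u P)) P + q P * u P = 0).

(* Main.v *)
Require Import Defs.
From Stdlib Require Import Reals Lra Classical ClassicalEpsilon.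
From Coquelicot Require Import Coquelicot.
Open Scope R_scope.

(** For vectorial [F] the equation [D F + F (Df / f) = 0] has a scalar part,
    [f div F + <grad f, F> = 0], and a vector part, [f rot F = grad f x F]
    ([vekua_components]).  The vector part says exactly that
    [rot (F / f) = 0] ([rot_quotient_zero]), so [F / f] has an antigradient
    [phi].  For [u = u0 phi] and [s^2 = p], [f = s u0], the flux splits as
    [p grad u = phi (p grad u0) + s F].  Its divergence is
    [- q u + p <grad phi, grad u0> + div (s F)], and the last two terms together
    are a multiple of the scalar part ([antigradient_solution]).

    What remains is analysis: the regularity of [F / f] and [u], and the
    existence of [phi].  Existence is proved for real fields, and applied to
    the real and imaginary parts.  In a cube the integral of a rot-free
    field along an edge path from [A] to [B] is a function of two points, also
    written [D], with [D A B + D B C = D A C] ([axis_integral_cocycle]); this follows from the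
    vanishing of the circulation around rectangles parallel to the axes
    ([rectangle_circulation]).  Such a local cocycle can be transported along
    any continuous path: a lift of [c] is a function [psi] whose increments near
    each parameter are those of [D] along [c].  Lifts exist, are unique up to a
    constant, and have total increment zero along null-homotopic loops
    ([null_homotopic_increment]), so a simply connected open set carries a
    function [phi] with [phi B - phi A = D A B] in each cube
    ([cocycle_potential]).  All passages from local to global statements on
    [[0, 1]] go through [cousin_induction], hence no integral along a path that
    is merely continuous is needed. *)

(** * Local-to-global induction on an interval *)

(** An additive property of intervals that holds for all short intervals around
    each point holds for the whole interval. *)
Lemma cousin_induction (P : R -> R -> Prop) (a b : R) :
  a <= b ->
  (forall x y z, a <= x <= y -> y <= z <= b -> P x y -> P y z -> P x z) ->
  (forall t, a <= t <= b -> exists d, 0 < d /\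
     forall x y, a <= x <= t -> t <= y <= b -> t - x < d -> y - t < d -> P x y) ->
  P a b.
Proof.
intros Hab Hadd Hloc.
set (S := fun x => a <= x <= b /\ P a x).
assert (Haa : P a a).
{ destruct (Hloc a) as [d [Hd H]]; [lra|]. apply H; lra. }
destruct (completeness S) as [m [Hub Hlub]].
- exists b. intros x [Hx _]. lra.
- exists a. split; [lra|exact Haa].
- assert (Ham : a <= m) by (apply Hub; split; [lra|exact Haa]).
  assert (Hmb : m <= b) by (apply Hlub; intros x [Hx _]; lra).
  destruct (Hloc m) as [d [Hd H]]; [lra|].
  assert (Hex : exists x, S x /\ m - d < x).
  { apply NNPP. intros Hn.
    assert (m <= m - d); [|lra].
    apply Hlub. intros x Hx. apply Rnot_lt_le. intros Hlt. apply Hn. now exists x. }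
  destruct Hex as [x [[Hx HPx] Hmx]].
  assert (Hxm : x <= m) by (apply Hub; split; assumption).
  (* if [m < b], the property extends beyond the supremum [m] *)
  set (y := Rmin b (m + d / 2)).
  assert (Hy : m <= y <= b /\ y - m < d).
  { unfold y, Rmin. destruct (Rle_dec b (m + d / 2)); lra. }
  assert (HPy : P a y).
  { apply (Hadd a x y); try lra; trivial. apply H; lra. }
  assert (Hym : y <= m) by (apply Hub; split; [lra|exact HPy]).
  assert (Hyb : y = b).
  { revert Hym. unfold y, Rmin. destruct (Rle_dec b (m + d / 2)); lra. }
  now rewrite <- Hyb.
Qed.

(** * Local cocycles and their transport along continuous paths *)

(** The balls of [R3] are open cubes with edges parallel to the axes. *)
Definition cube_in (G : R3 -> Prop) (P : R3) (r : R) : Prop :=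
  0 < r /\ forall Q, ball P r Q -> G Q.

(** A function of two points that behaves, inside each cube contained in [G],
    like the increment of a scalar function. *)
Definition local_cocycle (G : R3 -> Prop) (D : R3 -> R3 -> R) : Prop :=
  forall P r, cube_in G P r -> forall A B C,
  ball P r A -> ball P r B -> ball P r C -> D A B + D B C = D A C.

Lemma open_cube (G : R3 -> Prop) (P : R3) :
  open G -> G P -> exists r, cube_in G P r.
Proof.
intros HG HP. destruct (HG P HP) as [r Hr].
exists r. split; [apply cond_pos|exact Hr].
Qed.

Lemma cube_center (G : R3 -> Prop) P r : cube_in G P r -> ball P r P.
Proof. intros [Hr _]. exact (ball_center P (mkposreal r Hr)). Qed.

(** [c] is a continuous path in [G] over [[a, b]], and the increments of [psi]
    near each parameter [t] are those prescribed by [D] from the point [c t]. *)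
Definition lifted_path (G : R3 -> Prop) (D : R3 -> R3 -> R)
    (a b : R) (c : R -> R3) (psi : R -> R) : Prop :=
  forall t, a <= t <= b -> G (c t) /\
  forall eps, 0 < eps -> exists d, 0 < d /\
  forall s, a <= s <= b -> Rabs (s - t) < d ->
    ball (c t) eps (c s) /\ psi s - psi t = D (c t) (c s).

(** Paths in [G] over [[a, b]]; only the values of [c] on [[a, b]] matter. *)
Definition path_on (G : R3 -> Prop) (a b : R) (c : R -> R3) : Prop :=
  forall t, a <= t <= b -> G (c t) /\
  forall eps, 0 < eps -> exists d, 0 < d /\
  forall s, a <= s <= b -> Rabs (s - t) < d -> ball (c t) eps (c s).

Lemma lifted_path_path_on G D a b c psi :
  lifted_path G D a b c psi -> path_on G a b c.
Proof.
intros H t Ht. destruct (H t Ht) as [HG Hc]. split; [exact HG|].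
intros eps He. destruct (Hc eps He) as [d [Hd Hs]].
exists d. split; [exact Hd|]. intros s Hs1 Hs2. now apply Hs.
Qed.

Lemma continuous_on_eps {U V : UniformSpace} (D : U -> Prop) (f : U -> V) :
  continuous_on D f <->
  (forall x, D x -> forall eps, 0 < eps -> exists d, 0 < d /\
     forall y, D y -> ball x d y -> ball (f x) eps (f y)).
Proof.
split.
- intros H x Hx eps He.
  specialize (H x Hx (ball (f x) eps) (locally_ball (f x) (mkposreal eps He))).
  destruct H as [d Hd]. exists d. split; [apply cond_pos|].
  intros y Hy Hb. now apply Hd.
- intros H x Hx Q [eps HQ].
  destruct (H x Hx eps (cond_pos eps)) as [d [Hd Hf]].
  exists (mkposreal d Hd). intros y Hy HDy. apply HQ. now apply Hf.
Qed.

Lemma path_in_path_on G c : path_in G c <-> path_on G 0 1 c.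
Proof.
unfold path_in. rewrite continuous_on_eps. split.
- intros [Hc HG] t Ht. split; [now apply HG|]. exact (Hc t Ht).
- intros H. split.
  + intros t Ht. exact (proj2 (H t Ht)).
  + intros t Ht. exact (proj1 (H t Ht)).
Qed.

Section Transport.

Variables (G : R3 -> Prop) (D : R3 -> R3 -> R).
Hypothesis G_open : open G.
Hypothesis D_cocycle : local_cocycle G D.

Lemma cocycle_refl A : G A -> D A A = 0.
Proof.
intros HA. destruct (open_cube G A G_open HA) as [r Hr].
assert (HB := cube_center _ _ _ Hr).
generalize (D_cocycle A r Hr A A A HB HB HB). lra.
Qed.

Lemma lifted_path_in_cube P r a b c :
  cube_in G P r -> a <= b ->
  path_on G a b c -> (forall t, a <= t <= b -> ball P r (c t)) ->
  lifted_path G D a b c (fun t => D (c a) (c t)).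
Proof.
intros Hr Hab Hc HB t Ht. destruct (Hc t Ht) as [HG Hcont].
split; [exact HG|]. intros eps He. destruct (Hcont eps He) as [d [Hd Hs]].
exists d. split; [exact Hd|]. intros s Hs1 Hs2. split; [now apply Hs|].
assert (Ha : a <= a <= b) by lra.
generalize (D_cocycle P r Hr (c a) (c t) (c s) (HB a Ha) (HB t Ht) (HB s Hs1)).
lra.
Qed.

Lemma lifted_path_unique a b c psi1 psi2 :
  a <= b -> lifted_path G D a b c psi1 -> lifted_path G D a b c psi2 ->
  psi1 b - psi1 a = psi2 b - psi2 a.
Proof.
intros Hab H1 H2.
apply (cousin_induction (fun x y => psi1 y - psi1 x = psi2 y - psi2 x) a b Hab).
- intros; lra.
- intros t Ht.
  destruct (proj2 (H1 t Ht) 1 Rlt_0_1) as [d1 [Hd1 H1']].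
  destruct (proj2 (H2 t Ht) 1 Rlt_0_1) as [d2 [Hd2 H2']].
  exists (Rmin d1 d2). split; [now apply Rmin_pos|].
  intros x y Hx Hy Hdx Hdy.
  generalize (Rmin_l d1 d2) (Rmin_r d1 d2); intros.
  assert (Habs : forall s, t - Rmin d1 d2 < s < t + Rmin d1 d2 ->
    Rabs (s - t) < d1 /\ Rabs (s - t) < d2).
  { intros s Hs. split; apply Rabs_def1; lra. }
  destruct (Habs x) as [Hx1 Hx2]; [lra|]. destruct (Habs y) as [Hy1 Hy2]; [lra|].
  destruct (H1' x ltac:(lra) Hx1) as [_ E1]. destruct (H1' y ltac:(lra) Hy1) as [_ E2].
  destruct (H2' x ltac:(lra) Hx2) as [_ E3]. destruct (H2' y ltac:(lra) Hy2) as [_ E4].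
  lra.
Qed.

Lemma lifted_path_sub a b a' b' c psi :
  a <= a' -> b' <= b -> lifted_path G D a b c psi -> lifted_path G D a' b' c psi.
Proof.
intros Ha Hb H t Ht. destruct (H t ltac:(lra)) as [HG Hc]. split; [exact HG|].
intros eps He. destruct (Hc eps He) as [d [Hd Hs]]. exists d. split; [exact Hd|].
intros s Hs1 Hs2. apply Hs; [lra|exact Hs2].
Qed.

Lemma path_on_sub a b a' b' c :
  a <= a' -> b' <= b -> path_on G a b c -> path_on G a' b' c.
Proof.
intros Ha Hb H t Ht. destruct (H t ltac:(lra)) as [HG Hc]. split; [exact HG|].
intros eps He. destruct (Hc eps He) as [d [Hd Hs]]. exists d. split; [exact Hd|].
intros s Hs1 Hs2. apply Hs; [lra|exact Hs2].
Qed.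

Lemma lifted_path_cube_increment P r a b c psi :
  cube_in G P r -> a <= b -> lifted_path G D a b c psi ->
  (forall t, a <= t <= b -> ball P r (c t)) ->
  psi b - psi a = D (c a) (c b).
Proof.
intros Hr Hab H HB.
assert (Hc := lifted_path_path_on _ _ _ _ _ _ H).
rewrite (lifted_path_unique a b c psi (fun t => D (c a) (c t)) Hab H
  (lifted_path_in_cube P r a b c Hr Hab Hc HB)).
rewrite (cocycle_refl (c a)); [lra|]. apply Hc. lra.
Qed.

Lemma lifted_path_shift a b c psi k :
  lifted_path G D a b c psi -> lifted_path G D a b c (fun t => psi t + k).
Proof.
intros H t Ht. destruct (H t Ht) as [HG Hc]. split; [exact HG|].
intros eps He. destruct (Hc eps He) as [d [Hd Hs]]. exists d. split; [exact Hd|].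
intros s Hs1 Hs2. destruct (Hs s Hs1 Hs2). split; [assumption|lra].
Qed.

(** The function that follows [f] up to [b] and [g] afterwards. *)
Definition glue {T} (b : R) (f g : R -> T) (t : R) : T :=
  if Rle_dec t b then f t else g t.

Lemma glue_l {T} b (f g : R -> T) t : t <= b -> glue b f g t = f t.
Proof. intros H. unfold glue. destruct (Rle_dec t b); [reflexivity|lra]. Qed.

Lemma glue_r {T} b (f g : R -> T) t : f b = g b -> b <= t -> glue b f g t = g t.
Proof.
intros E H. unfold glue. destruct (Rle_dec t b); [|reflexivity].
now replace t with b by lra.
Qed.

Lemma lifted_path_glue a b e c psi c' psi' :
  lifted_path G D a b c psi -> lifted_path G D b e c' psi' ->
  c b = c' b -> psi b = psi' b ->
  lifted_path G D a e (glue b c c') (glue b psi psi').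
Proof.
intros H H' Ec Ep t Ht.
destruct (Rle_dec t b) as [Htb|Htb].
2:{ destruct (H' t ltac:(lra)) as [HG Hc].
  rewrite !(glue_r b _ _ t) by (trivial; lra). split; [exact HG|].
  intros eps He. destruct (Hc eps He) as [d [Hd Hs]].
  exists (Rmin d (t - b)). split; [apply Rmin_pos; lra|].
  intros s Hs1 Hs2. generalize (Rmin_l d (t - b)) (Rmin_r d (t - b)); intros.
  apply Rabs_def2 in Hs2.
  rewrite !(glue_r b _ _ s) by (trivial; lra).
  apply Hs; [lra|apply Rabs_def1; lra]. }
destruct (H t ltac:(lra)) as [HG Hc].
rewrite !(glue_l b _ _ t) by lra. split; [exact HG|].
intros eps He. destruct (Hc eps He) as [d [Hd Hs]].
destruct (Req_dec t b) as [->|Hne].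
- destruct (H' b ltac:(lra)) as [_ Hc']. destruct (Hc' eps He) as [d' [Hd' Hs']].
  exists (Rmin d d'). split; [now apply Rmin_pos|].
  intros s Hs1 Hs2. generalize (Rmin_l d d') (Rmin_r d d'); intros.
  destruct (Rle_dec s b).
  + rewrite !(glue_l b _ _ s) by lra. apply Hs; lra.
  + rewrite !(glue_r b _ _ s) by (trivial; lra). rewrite Ec, Ep. apply Hs'; lra.
- exists (Rmin d (b - t)). split; [apply Rmin_pos; lra|].
  intros s Hs1 Hs2. generalize (Rmin_l d (b - t)) (Rmin_r d (b - t)); intros.
  apply Rabs_def2 in Hs2.
  rewrite !(glue_l b _ _ s) by lra. apply Hs; [lra|apply Rabs_def1; lra].
Qed.

Lemma lifted_path_exists a b c :
  a <= b -> path_on G a b c -> exists psi, lifted_path G D a b c psi.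
Proof.
intros Hab Hc.
apply (cousin_induction (fun x y => exists psi, lifted_path G D x y c psi) a b Hab).
- intros x y z Hxy Hyz [psi H] [psi' H'].
  exists (glue y psi (fun t => psi' t + (psi y - psi' y))).
  assert (Hg : lifted_path G D x z (glue y c c)
    (glue y psi (fun t => psi' t + (psi y - psi' y)))).
  { apply lifted_path_glue; trivial; [now apply lifted_path_shift|lra]. }
  intros t Ht. destruct (Hg t Ht) as [HG Hd].
  assert (Egl : forall s, glue y c c s = c s)
    by (intros s; unfold glue; now destruct (Rle_dec s y)).
  rewrite Egl in HG. split; [exact HG|].
  intros eps He. destruct (Hd eps He) as [d [Hd0 Hs]].
  exists d. split; [exact Hd0|]. intros s Hs1 Hs2.
  specialize (Hs s Hs1 Hs2). now rewrite !Egl in Hs.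
- intros t Ht. destruct (Hc t Ht) as [HG Hcont].
  destruct (open_cube G (c t) G_open HG) as [r Hr].
  destruct (Hcont r (proj1 Hr)) as [d [Hd Hs]].
  exists d. split; [exact Hd|]. intros x y Hx Hy Hdx Hdy.
  exists (fun t => D (c x) (c t)).
  apply (lifted_path_in_cube (c t) r); trivial; [lra| |].
  + apply (path_on_sub a b); trivial; lra.
  + intros s Hs1. apply Hs; [lra|]. apply Rabs_def1; lra.
Qed.

(** The factor [k] may be negative: this covers the reversal of a path. *)
Lemma lifted_path_affine a b a' b' k m c psi :
  (forall t, a' <= t <= b' -> a <= k * t + m <= b) ->
  lifted_path G D a b c psi ->
  lifted_path G D a' b' (fun t => c (k * t + m)) (fun t => psi (k * t + m)).
Proof.
intros Hkm H t Ht. destruct (H _ (Hkm t Ht)) as [HG Hc]. split; [exact HG|].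
intros eps He. destruct (Hc eps He) as [d [Hd Hs]].
assert (Hk : 0 < Rabs k + 1) by (generalize (Rabs_pos k); lra).
exists (d / (Rabs k + 1)). split; [now apply Rdiv_lt_0_compat|].
intros s Hs1 Hs2. apply Hs; [now apply Hkm|].
replace (k * s + m - (k * t + m)) with (k * (s - t)) by ring.
rewrite Rabs_mult.
apply Rle_lt_trans with ((Rabs k + 1) * Rabs (s - t)).
- apply Rmult_le_compat_r; [apply Rabs_pos|lra].
- apply (Rmult_lt_compat_l _ _ _ Hk) in Hs2.
  replace ((Rabs k + 1) * (d / (Rabs k + 1))) with d in Hs2; [exact Hs2|].
  field. lra.
Qed.

(** [v] is the total increment of [D] along some path in [G] from [A] to [B]. *)
Definition transport (A B : R3) (v : R) : Prop :=
  exists c psi, lifted_path G D 0 1 c psi /\ c 0 = A /\ c 1 = B /\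
    psi 1 - psi 0 = v.

Lemma transport_exists A B :
  path_connected G -> G A -> G B -> exists v, transport A B v.
Proof.
intros Hp HA HB. destruct (Hp A B HA HB) as [c [Hc [H0 H1]]].
apply path_in_path_on in Hc.
destruct (lifted_path_exists 0 1 c Rle_0_1 Hc) as [psi Hpsi].
exists (psi 1 - psi 0), c, psi. exact (conj Hpsi (conj H0 (conj H1 eq_refl))).
Qed.

Lemma transport_sym A B v : transport A B v -> transport B A (- v).
Proof.
intros [c [psi [H [H0 [H1 Hv]]]]].
exists (fun t => c (-1 * t + 1)), (fun t => psi (-1 * t + 1)).
split; [|split; [|split]].
- apply (lifted_path_affine 0 1); [intros; lra|exact H].
- now replace (-1 * 0 + 1) with 1 by ring.
- now replace (-1 * 1 + 1) with 0 by ring.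
- replace (-1 * 0 + 1) with 1 by ring. replace (-1 * 1 + 1) with 0 by ring. lra.
Qed.

Lemma transport_trans A B C v w :
  transport A B v -> transport B C w -> transport A C (v + w).
Proof.
intros [c [psi [H [H0 [H1 Hv]]]]] [c' [psi' [H' [H0' [H1' Hw]]]]].
assert (L1 : lifted_path G D 0 (1 / 2)
  (fun t => c (2 * t + 0)) (fun t => psi (2 * t + 0)))
  by (apply (lifted_path_affine 0 1); [intros; lra|exact H]).
assert (L2 : lifted_path G D (1 / 2) 1 (fun t => c' (2 * t + -1))
  (fun t => psi' (2 * t + -1) + (psi 1 - psi' 0))).
{ apply (lifted_path_shift _ _ (fun t => c' (2 * t + -1))
    (fun t => psi' (2 * t + -1))).
  apply (lifted_path_affine 0 1); [intros; lra|exact H']. }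
assert (E0 : 2 * (1 / 2) + 0 = 1) by field.
assert (E1 : 2 * (1 / 2) + -1 = 0) by field.
eexists _, _. split; [|split; [|split]].
- apply (lifted_path_glue _ _ _ _ _ _ _ L1 L2); rewrite E0, E1.
  + now rewrite H1, H0'.
  + lra.
- rewrite glue_l by lra. now replace (2 * 0 + 0) with 0 by ring.
- rewrite glue_r by (try lra; now rewrite E0, E1, H1, H0').
  now replace (2 * 1 + -1) with 1 by ring.
- rewrite (glue_r (1 / 2) (fun t => psi (2 * t + 0))) by (rewrite ?E0, ?E1; lra).
  rewrite glue_l by lra.
  replace (2 * 1 + -1) with 1 by ring. replace (2 * 0 + 0) with 0 by ring. lra.
Qed.

Definition segment (A B : R3) (t : R) : R3 :=
  let '(x, y, z) := A in let '(x', y', z') := B in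
  (x + t * (x' - x), y + t * (y' - y), z + t * (z' - z)).

Lemma interval_convex (p r a b t : R) :
  0 <= t <= 1 -> Rabs (a - p) < r -> Rabs (b - p) < r ->
  Rabs (a + t * (b - a) - p) < r.
Proof.
intros Ht Ha Hb. apply Rabs_def2 in Ha. apply Rabs_def2 in Hb.
assert (K : forall X Y, 0 < X -> 0 < Y -> 0 < (1 - t) * X + t * Y).
{ intros X Y HX HY. destruct (Rle_lt_dec t 0).
  - replace t with 0 by lra. lra.
  - assert (0 < t * Y) by now apply Rmult_lt_0_compat.
    assert (0 <= (1 - t) * X) by (apply Rmult_le_pos; lra). lra. }
generalize (K (r - (a - p)) (r - (b - p)) ltac:(lra) ltac:(lra))
  (K (r + (a - p)) (r + (b - p)) ltac:(lra) ltac:(lra)); intros.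
apply Rabs_def1; lra.
Qed.

Lemma segment_in_cube P r A B t :
  ball P r A -> ball P r B -> 0 <= t <= 1 -> ball P r (segment A B t).
Proof.
destruct P as [[p1 p2] p3], A as [[a1 a2] a3], B as [[b1 b2] b3].
intros [[HA1 HA2] HA3] [[HB1 HB2] HB3] Ht.
split; [split|]; apply interval_convex; assumption.
Qed.

Lemma segment_continuous A B t eps :
  0 < eps -> exists d, 0 < d /\ forall s, Rabs (s - t) < d ->
  ball (segment A B t) eps (segment A B s).
Proof.
destruct A as [[a1 a2] a3], B as [[b1 b2] b3]. intros He.
set (M := Rabs (b1 - a1) + Rabs (b2 - a2) + Rabs (b3 - a3) + 1).
generalize (Rabs_pos (b1 - a1)) (Rabs_pos (b2 - a2)) (Rabs_pos (b3 - a3)).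
intros P1 P2 P3.
assert (HM : 0 < M) by (unfold M; lra).
exists (eps / M). split; [now apply Rdiv_lt_0_compat|].
intros s Hs.
assert (K : forall a b, Rabs (b - a) <= M ->
  Rabs (a + s * (b - a) - (a + t * (b - a))) < eps).
{ intros a b Hab.
  replace (a + s * (b - a) - (a + t * (b - a))) with ((b - a) * (s - t)) by ring.
  rewrite Rabs_mult.
  apply Rle_lt_trans with (M * Rabs (s - t)).
  - apply Rmult_le_compat_r; [apply Rabs_pos|exact Hab].
  - apply (Rmult_lt_compat_l _ _ _ HM) in Hs.
    replace (M * (eps / M)) with eps in Hs; [exact Hs|]. field. lra. }
split; [split|]; apply K; unfold M; lra.
Qed.

Lemma transport_in_cube P r A B :
  cube_in G P r -> ball P r A -> ball P r B -> transport A B (D A B).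
Proof.
intros Hr HA HB.
assert (E0 : segment A B 0 = A).
{ destruct A as [[a1 a2] a3], B as [[b1 b2] b3]. simpl.
  f_equal; [f_equal|]; ring. }
assert (E1 : segment A B 1 = B).
{ destruct A as [[a1 a2] a3], B as [[b1 b2] b3]. simpl.
  f_equal; [f_equal|]; ring. }
exists (segment A B), (fun t => D (segment A B 0) (segment A B t)).
split; [|split; [exact E0|split; [exact E1|]]].
- apply (lifted_path_in_cube P r); trivial; [lra| |].
  + intros t Ht. split.
    * apply Hr. now apply segment_in_cube.
    * intros eps He. destruct (segment_continuous A B t eps He) as [d [Hd Hs]].
      exists d. split; [exact Hd|]. intros s _. apply Hs.
  + intros t Ht. now apply segment_in_cube.
- rewrite E0, E1, cocycle_refl; [lra|]. now apply Hr.
Qed.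

(** Neighbouring stages of a homotopy have the same increment, up to the
    increments of [D] between their respective end points: this is additive in
    the subinterval of parameters, and on a short subinterval all points involved
    lie in one cube. *)
Lemma homotopy_increment_local (H : R * R -> R3) s :
  continuous_on unit_square H -> (forall st, unit_square st -> G (H st)) ->
  unit_interval s ->
  exists d, 0 < d /\ forall s', unit_interval s' -> Rabs (s' - s) < d ->
  forall psi psi',
    lifted_path G D 0 1 (fun t => H (s, t)) psi ->
    lifted_path G D 0 1 (fun t => H (s', t)) psi' ->
    D (H (s, 0)) (H (s', 0)) + (psi' 1 - psi' 0) =
    (psi 1 - psi 0) + D (H (s, 1)) (H (s', 1)).
Proof.
intros Hcont HG Hs. rewrite continuous_on_eps in Hcont.
apply (cousin_induction (fun a b => exists d, 0 < d /\
  forall s', unit_interval s' -> Rabs (s' - s) < d ->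
  forall psi psi',
    lifted_path G D 0 1 (fun t => H (s, t)) psi ->
    lifted_path G D 0 1 (fun t => H (s', t)) psi' ->
    D (H (s, a)) (H (s', a)) + (psi' b - psi' a) =
    (psi b - psi a) + D (H (s, b)) (H (s', b))) 0 1 Rle_0_1).
- intros x y z _ _ [d1 [Hd1 H1]] [d2 [Hd2 H2]].
  exists (Rmin d1 d2). split; [now apply Rmin_pos|].
  intros s' Hs' Hd psi psi' L L'.
  generalize (Rmin_l d1 d2) (Rmin_r d1 d2); intros.
  generalize (H1 s' Hs' ltac:(lra) psi psi' L L')
    (H2 s' Hs' ltac:(lra) psi psi' L L'). lra.
- intros t Ht.
  assert (Hst : unit_square (s, t)) by now split.
  destruct (open_cube G (H (s, t)) G_open (HG _ Hst)) as [r Hr].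
  destruct (Hcont (s, t) Hst r (proj1 Hr)) as [d [Hd Hb]].
  exists d. split; [exact Hd|]. intros x y Hx Hy Hdx Hdy.
  exists d. split; [exact Hd|]. intros s' Hs' Hds psi psi' L L'.
  assert (B : forall s1 t1, unit_interval s1 -> Rabs (s1 - s) < d ->
    x <= t1 <= y -> ball (H (s, t)) r (H (s1, t1))).
  { intros s1 t1 Hs1 Hds1 Ht1. apply Hb.
    - split; [exact Hs1|]. split; simpl; lra.
    - split; [exact Hds1|]. change (Rabs (t1 - t) < d). apply Rabs_def1; lra. }
  assert (Hss : Rabs (s - s) < d) by (rewrite Rminus_diag, Rabs_R0; exact Hd).
  rewrite (lifted_path_cube_increment _ r x y _ psi Hr ltac:(lra)
    (lifted_path_sub 0 1 x y _ _ ltac:(lra) ltac:(lra) L)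
    (fun t1 => B s t1 Hs Hss)).
  rewrite (lifted_path_cube_increment _ r x y _ psi' Hr ltac:(lra)
    (lifted_path_sub 0 1 x y _ _ ltac:(lra) ltac:(lra) L')
    (fun t1 => B s' t1 Hs' Hds)).
  assert (Bsx := B s x Hs Hss ltac:(lra)). assert (Bsy := B s y Hs Hss ltac:(lra)).
  assert (Bx := B s' x Hs' Hds ltac:(lra)). assert (By := B s' y Hs' Hds ltac:(lra)).
  rewrite (D_cocycle _ r Hr _ _ _ Bsx Bx By).
  now rewrite (D_cocycle _ r Hr _ _ _ Bsx Bsy By).
Qed.

(** The stages of the homotopy are loops with a common end point, so their
    increments agree with that of the final, constant loop. *)
Lemma null_homotopic_increment c psi :
  lifted_path G D 0 1 c psi -> null_homotopic G c -> psi 1 - psi 0 = 0.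
Proof.
intros L [H [Hcont [HG [H0 [H1 Hside]]]]].
assert (Hpath : forall s, unit_interval s -> path_on G 0 1 (fun t => H (s, t))).
{ intros s Hs t Ht. split; [apply HG; now split|].
  rewrite continuous_on_eps in Hcont. intros eps He.
  destruct (Hcont (s, t) (conj Hs Ht) eps He) as [d [Hd Hb]].
  exists d. split; [exact Hd|]. intros t1 Ht1 Hd1. apply Hb; [now split|].
  split; [exact (ball_center s (mkposreal d Hd))|exact Hd1]. }
assert (K : forall psi0 psi1,
  lifted_path G D 0 1 (fun t => H (0, t)) psi0 ->
  lifted_path G D 0 1 (fun t => H (1, t)) psi1 ->
  psi1 1 - psi1 0 = psi0 1 - psi0 0).
{ apply (cousin_induction (fun x y => forall psi0 psi1,
    lifted_path G D 0 1 (fun t => H (x, t)) psi0 ->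
    lifted_path G D 0 1 (fun t => H (y, t)) psi1 ->
    psi1 1 - psi1 0 = psi0 1 - psi0 0) 0 1 Rle_0_1).
  - intros x y z Hx Hy Hxy Hyz psi0 psi1 L0 L1.
    assert (Hy' : unit_interval y) by (split; lra).
    destruct (lifted_path_exists 0 1 _ Rle_0_1 (Hpath y Hy')) as [psi' L'].
    rewrite (Hyz psi' psi1 L' L1). now apply Hxy.
  - intros s Hs.
    destruct (homotopy_increment_local H s Hcont HG Hs) as [d [Hd Hloc]].
    exists d. split; [exact Hd|]. intros x y Hx Hy Hdx Hdy psi0 psi1 L0 L1.
    destruct (lifted_path_exists 0 1 _ Rle_0_1 (Hpath s Hs)) as [psi' L'].
    assert (Hx' : unit_interval x) by (split; lra).
    assert (Hy' : unit_interval y) by (split; lra).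
    assert (E : forall s' psi2, unit_interval s' -> Rabs (s' - s) < d ->
      lifted_path G D 0 1 (fun t => H (s', t)) psi2 ->
      psi2 1 - psi2 0 = psi' 1 - psi' 0).
    { intros s' psi2 Hs' Hds L2.
      generalize (Hloc s' Hs' Hds psi' psi2 L' L2).
      destruct (Hside s Hs) as [-> ->]. destruct (Hside s' Hs') as [-> ->]. lra. }
    rewrite (E x psi0), (E y psi1); trivial; apply Rabs_def1; lra. }
assert (L0 : lifted_path G D 0 1 (fun t => H (0, t)) psi).
{ intros t Ht. destruct (L t Ht) as [HGt Hc]. rewrite (H0 t Ht). split; [exact HGt|].
  intros eps He. destruct (Hc eps He) as [d [Hd Hb]]. exists d. split; [exact Hd|].
  intros s Hs. rewrite (H0 s Hs). now apply Hb. }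
assert (Hc0 : G (c 0)) by (apply (L 0); lra).
assert (L1 : lifted_path G D 0 1 (fun t => H (1, t)) (fun _ => 0)).
{ intros t Ht. rewrite (H1 t Ht). split; [exact Hc0|].
  intros eps He. exists 1. split; [lra|]. intros s Hs _. rewrite (H1 s Hs).
  split; [exact (ball_center (c 0) (mkposreal eps He))|].
  rewrite cocycle_refl; [lra|exact Hc0]. }
generalize (K _ _ L0 L1). lra.
Qed.

Lemma transport_loop A v : simply_connected G -> transport A A v -> v = 0.
Proof.
intros [_ Hsc] [c [psi [L [H0 [H1 <-]]]]].
apply (null_homotopic_increment c psi L). apply Hsc.
- apply path_in_path_on. now apply (lifted_path_path_on G D 0 1 c psi).
- now rewrite H0, H1.
Qed.

(** The potential at [P] is the increment of [D] along any path from a base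
    point to [P]; simple connectedness makes the choice of path irrelevant. *)
Theorem cocycle_potential :
  simply_connected_domain G ->
  exists phi : R3 -> R, forall P r, cube_in G P r ->
  forall A B, ball P r A -> ball P r B -> phi B - phi A = D A B.
Proof.
intros [_ [[P0 HP0] Hsc]].
exists (fun P => epsilon (inhabits 0) (transport P0 P)).
intros P r Hr A B HA HB.
assert (S : forall Q, G Q -> transport P0 Q (epsilon (inhabits 0) (transport P0 Q))).
{ intros Q HQ. apply epsilon_spec. now apply transport_exists; [apply Hsc| |]. }
assert (SA := S A (proj2 Hr A HA)). assert (SB := S B (proj2 Hr B HB)).
set (v := epsilon _ (transport P0 A)) in *. set (w := epsilon _ (transport P0 B)) in *.
assert (SAB := transport_in_cube P r A B Hr HA HB).
generalize (transport_loop P0 _ Hsc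
  (transport_trans _ _ _ _ _ (transport_trans _ _ _ _ _ SA SAB)
     (transport_sym _ _ _ SB))). lra.
Qed.

End Transport.

(** * Coordinates and partial derivatives in space *)

(** [l] is the partial derivative of [g] at [P] in the direction [k]; the values
    may be real or complex. *)
Definition is_pd {V : NormedModule R_AbsRing} (k : axis) (g : R3 -> V) (P : R3)
  (l : V) : Prop :=
  is_derive (fun t : R => g (set_coord k P t)) (coord k P) l.

Lemma set_coord_id k P : set_coord k P (coord k P) = P.
Proof. destruct P as [[x y] z]. now destruct k. Qed.

Lemma coord_set_coord k P t : coord k (set_coord k P t) = t.
Proof. destruct P as [[x y] z]. now destruct k. Qed.

Lemma set_coord_set_coord k P s t : set_coord k (set_coord k P s) t = set_coord k P t.
Proof. destruct P as [[x y] z]. now destruct k. Qed.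

Lemma ball_set_coord k P r A t :
  ball P r A -> Rabs (t - coord k P) < r -> ball P r (set_coord k A t).
Proof.
destruct P as [[p1 p2] p3], A as [[a1 a2] a3]. intros [[H1 H2] H3] Ht.
destruct k; (split; [split|]); assumption.
Qed.

Lemma coord_ball k P r A : ball P r A -> Rabs (coord k A - coord k P) < r.
Proof.
destruct P as [[p1 p2] p3], A as [[a1 a2] a3]. intros [[H1 H2] H3].
destruct k; assumption.
Qed.

Lemma continuous_slice {U V : UniformSpace} (i : U -> R3) (g : R3 -> V) x :
  (forall (eps : posreal) y, ball x eps y -> ball (i x) eps (i y)) ->
  continuous g (i x) -> continuous (fun y => g (i y)) x.
Proof.
intros Hi Hg. apply (continuous_comp i g); [|exact Hg].
apply filterlim_locally. intros eps. exists eps. intros y. apply Hi.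
Qed.

Lemma is_pd_ext_open {V : NormedModule R_AbsRing} (G : R3 -> Prop) k (g h : R3 -> V) P l :
  open G -> (forall Q, G Q -> g Q = h Q) -> G P -> is_pd k g P l -> is_pd k h P l.
Proof.
intros HG Hgh HP. apply is_derive_ext_loc.
destruct (HG P HP) as [d Hd]. exists d. intros t Ht. apply Hgh, Hd.
destruct P as [[x y] z].
destruct k; (split; [split|]); first [exact Ht | apply ball_center].
Qed.

(** * Real fields with zero rot *)

Lemma between_in_interval x0 r a b t :
  Rabs (a - x0) < r -> Rabs (b - x0) < r -> Rmin a b <= t <= Rmax a b ->
  Rabs (t - x0) < r.
Proof.
intros Ha Hb Ht. apply Rabs_def2 in Ha. apply Rabs_def2 in Hb.
unfold Rmin, Rmax in Ht. destruct (Rle_dec a b); apply Rabs_def1; lra.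
Qed.

Lemma locally_interval x0 r x :
  Rabs (x - x0) < r -> locally x (fun y => Rabs (y - x0) < r).
Proof.
intros Hx. apply Rabs_def2 in Hx.
assert (Hd : 0 < Rmin (r - (x - x0)) (r + (x - x0))) by (apply Rmin_pos; lra).
exists (mkposreal _ Hd). intros y Hy. change (Rabs (y - x) < Rmin (r - (x - x0)) (r + (x - x0))) in Hy.
generalize (Rmin_l (r - (x - x0)) (r + (x - x0)))
  (Rmin_r (r - (x - x0)) (r + (x - x0))); intros.
apply Rabs_def2 in Hy. apply Rabs_def1; lra.
Qed.

Lemma ex_RInt_interval (f : R -> R) x0 r a b :
  (forall t, Rabs (t - x0) < r -> continuous f t) ->
  Rabs (a - x0) < r -> Rabs (b - x0) < r -> ex_RInt f a b.
Proof.
intros Hf Ha Hb. apply (ex_RInt_continuous (V := R_CompleteNormedModule)).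
intros t Ht. apply Hf. now apply (between_in_interval x0 r a b).
Qed.

Lemma is_derive_RInt_interval (f : R -> R) x0 r a x :
  (forall t, Rabs (t - x0) < r -> continuous f t) ->
  Rabs (a - x0) < r -> Rabs (x - x0) < r ->
  is_derive (fun y => RInt f a y) x (f x).
Proof.
intros Hf Ha Hx. apply (is_derive_RInt f _ a x).
- apply (filter_imp (fun y => Rabs (y - x0) < r)).
  + intros y Hy. apply (RInt_correct (V := R_CompleteNormedModule)).
    now apply (ex_RInt_interval f x0 r).
  + now apply locally_interval.
- now apply Hf.
Qed.

Lemma is_derive_zero_interval (h : R -> R) x0 r a b :
  (forall t, Rabs (t - x0) < r -> is_derive h t 0) ->
  Rabs (a - x0) < r -> Rabs (b - x0) < r -> h a = h b.
Proof.
intros Hh Ha Hb. destruct (Rtotal_order a b) as [Hab|[->|Hab]]; [|reflexivity|].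
- apply (eq_is_derive (V := R_NormedModule) h a b); [|exact Hab].
  intros t Ht. apply Hh. apply (between_in_interval x0 r a b); trivial.
  rewrite Rmin_left, Rmax_right; lra.
- symmetry. apply (eq_is_derive (V := R_NormedModule) h b a); [|exact Hab].
  intros t Ht. apply Hh. apply (between_in_interval x0 r b a); trivial.
  rewrite Rmin_left, Rmax_right; lra.
Qed.

Section Rectangle.

Variables (u v w : R -> R -> R) (x0 y0 r : R).

Let inside x y := Rabs (x - x0) < r /\ Rabs (y - y0) < r.

Hypothesis u_x : forall x y, inside x y -> continuous (fun t => u t y) x.
Hypothesis v_y : forall x y, inside x y -> continuous (fun t => v x t) y.
Hypothesis u_dy : forall x y, inside x y -> is_derive (fun t => u x t) y (w x y).
Hypothesis v_dx : forall x y, inside x y -> is_derive (fun t => v t y) x (w x y).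
Hypothesis w_cont : forall x y, inside x y ->
  continuous (fun z : R * R => w (fst z) (snd z)) (x, y).

(** The two edge paths from [(x1, y1)] to [(x2, y2)] give the same integral of
    [u dx + v dy] when [u_y = v_x = w]. *)
Lemma rectangle_circulation x1 x2 y1 y2 :
  inside x1 y1 -> inside x2 y2 ->
  RInt (fun t => u t y1) x1 x2 + RInt (fun t => v x2 t) y1 y2 =
  RInt (fun t => v x1 t) y1 y2 + RInt (fun t => u t y2) x1 x2.
Proof.
intros [Hx1 Hy1] [Hx2 Hy2].
(* the difference of the two sides, as a function of [x2], has derivative zero *)
set (h := fun x => RInt (fun t => u t y1) x1 x + RInt (fun t => v x t) y1 y2
  - RInt (fun t => u t y2) x1 x).
enough (E : h x1 = h x2).
{ unfold h in E.
  rewrite !(RInt_point (V := R_CompleteNormedModule)) in E.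
  change (@zero R_CompleteNormedModule) with 0 in E. lra. }
apply (is_derive_zero_interval h x0 r); trivial.
intros x Hx.
assert (Hdw : forall x t, Rabs (x - x0) < r -> Rabs (t - y0) < r ->
  Derive (fun s => v s t) x = w x t).
{ intros x' t Hx' Ht. apply is_derive_unique. apply v_dx. now split. }
assert (Hw : is_RInt (fun t => w x t) y1 y2 (u x y2 - u x y1)).
{ apply (is_RInt_derive (V := R_CompleteNormedModule) (fun t => u x t)).
  - intros t Ht. apply u_dy. split; [exact Hx|].
    now apply (between_in_interval y0 r y1 y2).
  - intros t Ht.
    apply (continuous_comp (fun t => (x, t)) (fun z : R * R => w (fst z) (snd z))).
    + apply filterlim_locally. intros eps. exists eps. intros y Hy.
      split; [apply ball_center|exact Hy].
    + apply w_cont. split; [exact Hx|]. now apply (between_in_interval y0 r y1 y2). }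
assert (Hv : is_derive (fun x => RInt (fun t => v x t) y1 y2) x (u x y2 - u x y1)).
{ evar_last.
  - apply (is_derive_RInt_param (fun x t => v x t) y1 y2 x).
    + apply (filter_imp (fun x' => Rabs (x' - x0) < r)); [|now apply locally_interval].
      intros x' Hx' t Ht. exists (w x' t). apply v_dx. split; [exact Hx'|].
      now apply (between_in_interval y0 r y1 y2).
    + intros t Ht. assert (Ht' := between_in_interval y0 r y1 y2 t Hy1 Hy2 Ht).
      apply (continuity_2d_pt_ext_loc w).
      * destruct (locally_interval x0 r x Hx) as [d1 Hd1].
        destruct (locally_interval y0 r t Ht') as [d2 Hd2].
        exists (mkposreal _ (Rmin_pos _ _ (cond_pos d1) (cond_pos d2))). simpl.
        intros x' t' Hx' Ht1. symmetry. apply Hdw; [apply Hd1|apply Hd2].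
        -- exact (Rlt_le_trans _ _ _ Hx' (Rmin_l _ _)).
        -- exact (Rlt_le_trans _ _ _ Ht1 (Rmin_r _ _)).
      * apply continuity_2d_pt_filterlim. apply w_cont. now split.
    + apply (filter_imp (fun x' => Rabs (x' - x0) < r)); [|now apply locally_interval].
      intros x' Hx'. apply (ex_RInt_interval _ y0 r); trivial.
      intros t Ht. apply v_y. now split.
  - rewrite <- (is_RInt_unique _ _ _ _ Hw).
    apply (RInt_ext (V := R_CompleteNormedModule)). intros t Ht. apply Hdw; [exact Hx|].
    apply (between_in_interval y0 r y1 y2); trivial; lra. }
evar_last.
- apply (is_derive_minus (V := R_NormedModule)).
  + apply (is_derive_plus (V := R_NormedModule)); [|exact Hv].
    apply (is_derive_RInt_interval (fun t => u t y1) x0 r); trivial.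
    intros t Ht. apply u_x. now split.
  + apply (is_derive_RInt_interval (fun t => u t y2) x0 r); trivial.
    intros t Ht. apply u_x. now split.
- change (u x y1 + (u x y2 - u x y1) - u x y2 = 0). ring.
Qed.

End Rectangle.

Section Potential.

(* [w12], [w13], [w23] are the common values of the pairs of partial derivatives
   whose differences are the components of the rot *)
Variables (G : R3 -> Prop) (e1 e2 e3 w12 w13 w23 : R3 -> R).
Hypothesis G_open : open G.
Hypothesis e_cont : forall P, G P -> continuous e1 P /\ continuous e2 P /\ continuous e3 P.
Hypothesis w_cont : forall P, G P -> continuous w12 P /\ continuous w13 P /\ continuous w23 P.
Hypothesis e_w12 : forall P, G P -> is_pd axY e1 P (w12 P) /\ is_pd axX e2 P (w12 P).
Hypothesis e_w13 : forall P, G P -> is_pd axZ e1 P (w13 P) /\ is_pd axX e3 P (w13 P).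
Hypothesis e_w23 : forall P, G P -> is_pd axZ e2 P (w23 P) /\ is_pd axY e3 P (w23 P).

(** The integral of [e1 dx + e2 dy + e3 dz] along the edge path from [A] to [B]
    that runs parallel to the x, y and z axes in this order. *)
Definition axis_integral (A B : R3) : R :=
  let '(x, y, z) := A in let '(x', y', z') := B in
  RInt (fun t => e1 (t, y, z)) x x' + RInt (fun t => e2 (x', t, z)) y y'
  + RInt (fun t => e3 (x', y', t)) z z'.

Lemma continuous_along_axis (g : R3 -> R) k P :
  continuous g P -> continuous (fun t => g (set_coord k P t)) (coord k P).
Proof.
intros Hg. apply (continuous_slice (set_coord k P)).
- intros eps y Hy. destruct P as [[p1 p2] p3].
  destruct k; (split; [split|]); first [exact Hy | apply ball_center].
- destruct P as [[p1 p2] p3]. now destruct k.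
Qed.

(** Three rectangles, one in each coordinate plane, turn the edge path from
    [A] to [C] through [B] into the edge path from [A] to [C]. *)
Lemma axis_integral_cocycle : local_cocycle G axis_integral.
Proof.
intros [[p1 p2] p3] r [Hr HG] [[xA yA] zA] [[xB yB] zB] [[xC yC] zC]
  [[HxA HyA] HzA] [[HxB HyB] HzB] [[HxC HyC] HzC].
change (Rabs (xA - p1) < r) in HxA. change (Rabs (yA - p2) < r) in HyA.
change (Rabs (zA - p3) < r) in HzA. change (Rabs (xB - p1) < r) in HxB.
change (Rabs (yB - p2) < r) in HyB. change (Rabs (zB - p3) < r) in HzB.
change (Rabs (xC - p1) < r) in HxC. change (Rabs (yC - p2) < r) in HyC.
change (Rabs (zC - p3) < r) in HzC.
assert (HG' : forall x y z, Rabs (x - p1) < r -> Rabs (y - p2) < r ->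
  Rabs (z - p3) < r -> G (x, y, z)).
{ intros x y z Hx Hy Hz. apply HG. now repeat split. }
assert (C1 : forall x y z, Rabs (x - p1) < r -> Rabs (y - p2) < r ->
  Rabs (z - p3) < r -> continuous (fun t => e1 (t, y, z)) x).
{ intros x y z Hx Hy Hz.
  apply (continuous_along_axis e1 axX (x, y, z)). now apply e_cont, HG'. }
assert (C2 : forall x y z, Rabs (x - p1) < r -> Rabs (y - p2) < r ->
  Rabs (z - p3) < r -> continuous (fun t => e2 (x, t, z)) y).
{ intros x y z Hx Hy Hz.
  apply (continuous_along_axis e2 axY (x, y, z)). now apply e_cont, HG'. }
assert (C3 : forall x y z, Rabs (x - p1) < r -> Rabs (y - p2) < r ->
  Rabs (z - p3) < r -> continuous (fun t => e3 (x, y, t)) z).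
{ intros x y z Hx Hy Hz.
  apply (continuous_along_axis e3 axZ (x, y, z)). now apply e_cont, HG'. }
assert (S12 : forall z, Rabs (z - p3) < r ->
  RInt (fun t => e1 (t, yA, z)) xB xC + RInt (fun t => e2 (xC, t, z)) yA yB =
  RInt (fun t => e2 (xB, t, z)) yA yB + RInt (fun t => e1 (t, yB, z)) xB xC).
{ intros z Hz.
  apply (rectangle_circulation (fun x y => e1 (x, y, z)) (fun x y => e2 (x, y, z))
    (fun x y => w12 (x, y, z)) p1 p2 r); try (now split).
  - intros x y [Hx Hy]. now apply C1.
  - intros x y [Hx Hy]. now apply C2.
  - intros x y [Hx Hy]. apply (e_w12 (x, y, z)). now apply HG'.
  - intros x y [Hx Hy]. apply (e_w12 (x, y, z)). now apply HG'.
  - intros x y [Hx Hy].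
    apply (continuous_slice (fun q : R * R => (fst q, snd q, z)) w12 (x, y)).
    + intros eps [x' y'] [Hx' Hy']. split; [now split|apply ball_center].
    + apply w_cont. now apply HG'. }
assert (S13 : 
  RInt (fun t => e1 (t, yB, zA)) xB xC + RInt (fun t => e3 (xC, yB, t)) zA zB =
  RInt (fun t => e3 (xB, yB, t)) zA zB + RInt (fun t => e1 (t, yB, zB)) xB xC).
{ apply (rectangle_circulation (fun x z => e1 (x, yB, z)) (fun x z => e3 (x, yB, z))
    (fun x z => w13 (x, yB, z)) p1 p3 r); try (now split).
  - intros x z [Hx Hz]. now apply C1.
  - intros x z [Hx Hz]. now apply C3.
  - intros x z [Hx Hz]. apply (e_w13 (x, yB, z)). now apply HG'.
  - intros x z [Hx Hz]. apply (e_w13 (x, yB, z)). now apply HG'.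
  - intros x z [Hx Hz].
    apply (continuous_slice (fun q : R * R => (fst q, yB, snd q)) w13 (x, z)).
    + intros eps [x' z'] [Hx' Hz']. split; [split; [exact Hx'|apply ball_center]|exact Hz'].
    + apply w_cont. now apply HG'. }
assert (S23 : 
  RInt (fun t => e2 (xC, t, zA)) yB yC + RInt (fun t => e3 (xC, yC, t)) zA zB =
  RInt (fun t => e3 (xC, yB, t)) zA zB + RInt (fun t => e2 (xC, t, zB)) yB yC).
{ apply (rectangle_circulation (fun y z => e2 (xC, y, z)) (fun y z => e3 (xC, y, z))
    (fun y z => w23 (xC, y, z)) p2 p3 r); try (now split).
  - intros y z [Hy Hz]. now apply C2.
  - intros y z [Hy Hz]. now apply C3.
  - intros y z [Hy Hz]. apply (e_w23 (xC, y, z)). now apply HG'.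
  - intros y z [Hy Hz]. apply (e_w23 (xC, y, z)). now apply HG'.
  - intros y z [Hy Hz].
    apply (continuous_slice (fun q : R * R => (xC, fst q, snd q)) w23 (y, z)).
    + intros eps [y' z'] [Hy' Hz']. split; [split; [apply ball_center|exact Hy']|exact Hz'].
    + apply w_cont. now apply HG'. }
assert (Ch : forall f x0 a b c, (forall t, Rabs (t - x0) < r -> continuous f t) ->
  Rabs (a - x0) < r -> Rabs (b - x0) < r -> Rabs (c - x0) < r ->
  RInt f a b + RInt f b c = RInt f a c).
{ intros f x0 a b c Hf Ha Hb Hc. apply (RInt_Chasles (V := R_CompleteNormedModule));
  now apply (ex_RInt_interval f x0 r). }
assert (X := Ch (fun t => e1 (t, yA, zA)) p1 xA xB xC
  (fun t Ht => C1 t yA zA Ht HyA HzA) HxA HxB HxC).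
assert (Y := Ch (fun t => e2 (xC, t, zA)) p2 yA yB yC
  (fun t Ht => C2 xC t zA HxC Ht HzA) HyA HyB HyC).
assert (Z := Ch (fun t => e3 (xC, yC, t)) p3 zA zB zC
  (fun t Ht => C3 xC yC t HxC HyC Ht) HzA HzB HzC).
assert (S12A := S12 zA HzA).
unfold axis_integral. change (UniformSpace.sort R_UniformSpace) with R in *. lra.
Qed.

Lemma is_pd_axis_integral (phi : R3 -> R) :
  (forall P r, cube_in G P r -> forall A B, ball P r A -> ball P r B ->
     phi B - phi A = axis_integral A B) ->
  forall P, G P ->
  is_pd axX phi P (e1 P) /\ is_pd axY phi P (e2 P) /\ is_pd axZ phi P (e3 P).
Proof.
intros Hphi P HP. destruct (open_cube G P G_open HP) as [r Hr].
assert (HPP := cube_center _ _ _ Hr).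
assert (K : forall k (e : R3 -> R), (forall Q, G Q -> continuous e Q) ->
  (forall t, axis_integral P (set_coord k P t) =
     RInt (fun s => e (set_coord k P s)) (coord k P) t) ->
  is_pd k phi P (e P)).
{ intros k e He HD. unfold is_pd.
  assert (HB : forall t, Rabs (t - coord k P) < r -> ball P r (set_coord k P t)).
  { intros t Ht.
    destruct P as [[p1 p2] p3]. destruct HPP as [[H1 H2] H3].
    destruct k; (split; [split|]); assumption. }
  apply (is_derive_ext_loc
    (fun t => phi P + RInt (fun s => e (set_coord k P s)) (coord k P) t)).
  - exists (mkposreal r (proj1 Hr)). intros t Ht.
    rewrite <- HD, <- (Hphi P r Hr P _ HPP (HB t Ht)). simpl. ring.
  - evar_last.
    + apply (is_derive_plus (V := R_NormedModule)).
      * apply is_derive_const.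
      * apply (is_derive_RInt_interval _ (coord k P) r).
        -- intros t Ht.
           assert (Et : coord k (set_coord k P t) = t)
             by (destruct P as [[p1 p2] p3]; now destruct k).
           assert (Hc := continuous_along_axis e k (set_coord k P t)
             (He _ (proj2 Hr _ (HB t Ht)))).
           rewrite Et in Hc. revert Hc. apply continuous_ext. intros s.
           destruct P as [[p1 p2] p3]; now destruct k.
        -- rewrite Rminus_diag, Rabs_R0. apply Hr.
        -- rewrite Rminus_diag, Rabs_R0. apply Hr.
    + replace (set_coord k P (coord k P)) with P
        by (destruct P as [[p1 p2] p3]; now destruct k).
      apply (Rplus_0_l (e P)). }
assert (R0 : forall (f : R -> R) a, RInt f a a = 0)
  by (intros f a; apply (RInt_point (V := R_CompleteNormedModule))).
destruct P as [[p1 p2] p3].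
split; [|split]; apply K; try (intros; now apply e_cont); intros t; simpl;
  rewrite !R0; ring.
Qed.

Theorem poincare_lemma :
  simply_connected_domain G ->
  exists phi : R3 -> R, forall P, G P ->
  is_pd axX phi P (e1 P) /\ is_pd axY phi P (e2 P) /\ is_pd axZ phi P (e3 P).
Proof.
intros Hsc.
destruct (cocycle_potential G axis_integral G_open axis_integral_cocycle Hsc)
  as [phi Hphi].
exists phi. now apply is_pd_axis_integral.
Qed.

End Potential.

(** * Continuity from continuous partial derivatives *)

Lemma continuous_of_partials (G : R3 -> Prop) (g : R3 -> R) (d : axis -> R3 -> R) :
  open G ->
  (forall k P, G P -> is_pd k g P (d k P)) ->
  (forall k P, G P -> continuous (d k) P) ->
  forall P, G P -> continuous g P.
Proof.
intros HG Hd Hc P HP.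
assert (Hb : forall k, locally P (fun Q => Rabs (d k Q) <= Rabs (d k P) + 1)).
{ intros k. assert (L := proj1 (filterlim_locally _ _) (Hc k P HP) (mkposreal 1 Rlt_0_1)).
  revert L. apply filter_imp. intros Q HQ.
  change (Rabs (d k Q - d k P) < 1) in HQ.
  generalize (Rabs_triang (d k P) (d k Q - d k P)).
  replace (d k P + (d k Q - d k P)) with (d k Q) by ring. lra. }
destruct (filter_and _ _ (HG P HP)
  (filter_and _ _ (Hb axX) (filter_and _ _ (Hb axY) (Hb axZ)))) as [r Hr].
set (M := Rabs (d axX P) + Rabs (d axY P) + Rabs (d axZ P) + 1).
assert (HM : 0 < M).
{ unfold M. generalize (Rabs_pos (d axX P)) (Rabs_pos (d axY P)) (Rabs_pos (d axZ P)). lra. }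
assert (HrG : forall Q, ball P r Q -> G Q) by (intros Q HQ; now apply Hr).
assert (HrM : forall k Q, ball P r Q -> Rabs (d k Q) <= M).
{ intros k Q HQ. destruct (Hr Q HQ) as [_ [H1 [H2 H3]]]. unfold M.
  generalize (Rabs_pos (d axX P)) (Rabs_pos (d axY P)) (Rabs_pos (d axZ P)).
  destruct k; lra. }
assert (step : forall k A t, ball P r A -> coord k A = coord k P ->
  Rabs (t - coord k P) < r ->
  Rabs (g (set_coord k A t) - g A) <= M * Rabs (t - coord k P)).
{ intros k A t HA HkA Ht.
  generalize (bounded_variation (fun s => g (set_coord k A s))
    (fun s => d k (set_coord k A s)) M (coord k A) t).
  rewrite set_coord_id, HkA. intros H. apply H. intros s Hs.
  assert (HB : ball P r (set_coord k A s)) by (apply ball_set_coord; [exact HA|lra]).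
  split; [|now apply HrM].
  generalize (Hd k _ (HrG _ HB)). unfold is_pd. rewrite coord_set_coord.
  apply is_derive_ext. intros u. now rewrite set_coord_set_coord. }
apply filterlim_locally. intros eps.
assert (Hrho : 0 < Rmin r (eps / (3 * M))).
{ apply Rmin_pos; [apply cond_pos|]. apply Rdiv_lt_0_compat; [apply cond_pos|lra]. }
exists (mkposreal _ Hrho). intros Q HQ. simpl in HQ.
assert (HQr : ball P r Q) by (exact (ball_le P _ _ (Rmin_l _ _) Q HQ)).
assert (HPr : ball P r P) by apply ball_center.
assert (Hk : forall k, Rabs (coord k Q - coord k P) < r /\
  M * Rabs (coord k Q - coord k P) < eps / 3).
{ intros k. split; [now apply coord_ball|].
  assert (H := Rlt_le_trans _ _ _ (coord_ball k _ _ _ HQ) (Rmin_r _ _)).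
  apply (Rmult_lt_compat_l M) in H; [|exact HM].
  replace (M * (eps / (3 * M))) with (eps / 3) in H; [exact H|]. field. lra. }
(* P is joined to Q by three segments parallel to the axes *)
set (A := set_coord axX P (coord axX Q)). set (B := set_coord axY A (coord axY Q)).
assert (EQ : Q = set_coord axZ B (coord axZ Q)).
{ unfold B, A. destruct P as [[p1 p2] p3], Q as [[x y] z]. reflexivity. }
assert (HA : ball P r A) by (apply ball_set_coord; [exact HPr|apply Hk]).
assert (HB : ball P r B) by (apply ball_set_coord; [exact HA|apply Hk]).
assert (S1 := step axX P (coord axX Q) HPr eq_refl (proj1 (Hk axX))).
assert (S2 : Rabs (g B - g A) <= M * Rabs (coord axY Q - coord axY P)).
{ apply (step axY A); [exact HA| |apply Hk]. unfold A. now destruct P as [[p1 p2] p3]. }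
assert (S3 : Rabs (g Q - g B) <= M * Rabs (coord axZ Q - coord axZ P)).
{ rewrite EQ at 1. apply (step axZ B); [exact HB| |apply Hk].
  unfold B, A. now destruct P as [[p1 p2] p3]. }
fold A in S1.
change (Rabs (g Q - g P) < eps).
replace (g Q - g P) with ((g Q - g B) + ((g B - g A) + (g A - g P))) by ring.
generalize (Rabs_triang (g Q - g B) ((g B - g A) + (g A - g P)))
  (Rabs_triang (g B - g A) (g A - g P)) (Hk axX) (Hk axY) (Hk axZ). lra.
Qed.

(** * Partial derivatives of complex valued functions *)

Lemma is_derive_C (h : R -> C) x (l : C) :
  is_derive (V := C_R_NormedModule) h x l <->
  is_derive (fun t => Re (h t)) x (Re l) /\ is_derive (fun t => Im (h t)) x (Im l).
Proof.
split.
- intros H. split.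
  + apply (filterdiff_comp' (V := C_R_NormedModule) h fst x _ fst H).
    apply filterdiff_linear. apply is_linear_fst.
  + apply (filterdiff_comp' (V := C_R_NormedModule) h snd x _ snd H).
    apply filterdiff_linear. apply is_linear_snd.
- intros [H1 H2].
  assert (K : filterdiff (U := R_NormedModule) (V := C_R_NormedModule)
    (fun t : R => (Re (h t), Im (h t))) (locally x)
    (fun y : R => (y * Re l, y * Im l))).
  { apply (filterdiff_comp'_2 (T := R_NormedModule) (U := R_NormedModule)
      (V := R_NormedModule) (W := C_R_NormedModule)
      (fun t : R => Re (h t)) (fun t : R => Im (h t)) pair x
      (fun y : R => y * Re l) (fun y : R => y * Im l) pair H1 H2).
    apply (filterdiff_ext (U := prod_NormedModule _ R_NormedModule R_NormedModule)
      (V := C_R_NormedModule) (fun t => t)); [now intros []|].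
    apply (filterdiff_ext_lin _ (fun t => t)); [|now intros []].
    apply filterdiff_id. }
  apply (filterdiff_ext (U := R_NormedModule) (V := C_R_NormedModule)
    (fun t : R => (Re (h t), Im (h t)))).
  + intros t. now destruct (h t).
  + apply (filterdiff_ext_lin _ _ _ K). intros y. now destruct l.
Qed.

Lemma is_pd_C k (g : R3 -> C) P (l : C) :
  is_pd (V := C_R_NormedModule) k g P l <->
  is_pd k (fun Q => Re (g Q)) P (Re l) /\ is_pd k (fun Q => Im (g Q)) P (Im l).
Proof. apply is_derive_C. Qed.

Notation is_pdC := (is_pd (V := C_R_NormedModule)).

Lemma is_pd_unique k g P l : is_pdC k g P l -> pd k g P = l.
Proof.
intros H. apply is_pd_C in H. destruct H as [H1 H2]. destruct l as [l1 l2].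
unfold pd. f_equal; now apply is_derive_unique.
Qed.

Lemma is_pd_ex k g P l : is_pdC k g P l -> ex_pd k g P.
Proof. intros H. exists l. exact H. Qed.

Lemma ex_pd_correct k g P : ex_pd k g P -> is_pdC k g P (pd k g P).
Proof. intros [l Hl]. now rewrite (is_pd_unique k g P l Hl). Qed.

Lemma is_pd_plus k (g h : R3 -> C) P (a b : C) :
  is_pdC k g P a -> is_pdC k h P b -> is_pdC k (fun Q => g Q + h Q)%C P (a + b)%C.
Proof. exact (is_derive_plus (V := C_R_NormedModule) _ _ _ a b). Qed.

(* Presents an equation between real components of complex numbers as one that
   the real field tactics accept. *)
Ltac real_components :=
  cbv beta; rewrite ?set_coord_id;
  lazymatch goal with |- @eq _ ?x ?y => change (@eq R x y) end;
  unfold minus, plus, opp, Re, Im in *; simpl in *; unfold Re, Im in *.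

Lemma is_pd_mult k (g h : R3 -> C) P (a b : C) :
  is_pdC k g P a -> is_pdC k h P b ->
  is_pdC k (fun Q => g Q * h Q)%C P (a * h P + g P * b)%C.
Proof.
rewrite !is_pd_C. unfold is_pd. intros [G1 G2] [H1 H2].
assert (M : forall f1 f2 l1 l2, is_derive f1 (coord k P) l1 ->
  is_derive f2 (coord k P) l2 -> is_derive (fun t : R => f1 t * f2 t) (coord k P)
  (l1 * f2 (coord k P) + f1 (coord k P) * l2)).
{ intros. apply (is_derive_mult (K := R_AbsRing)); trivial. intros; apply Rmult_comm. }
split; evar_last.
- apply (is_derive_minus (V := R_NormedModule)); apply M; eassumption.
- real_components. ring.
- apply (is_derive_plus (V := R_NormedModule)); apply M; eassumption.
- real_components. ring.
Qed.

Lemma C_norm2_neq_0 (c : C) : c <> 0%C -> (Re c) ^ 2 + (Im c) ^ 2 <> 0.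
Proof.
intros Hc E. apply Hc. destruct c as [a b]. simpl in E.
apply injective_projections; simpl; nra.
Qed.

Lemma is_pd_inv k (g : R3 -> C) P (a : C) :
  g P <> 0%C -> is_pdC k g P a -> is_pdC k (fun Q => / g Q)%C P (- a * (/ g P * / g P))%C.
Proof.
rewrite !is_pd_C. unfold is_pd. intros Hg [G1 G2].
assert (HN := C_norm2_neq_0 _ Hg).
assert (N : is_derive (fun t => Re (g (set_coord k P t)) ^ 2 + Im (g (set_coord k P t)) ^ 2)
  (coord k P) (2 * Re a * Re (g P) + 2 * Im a * Im (g P))).
{ evar_last.
  - apply (is_derive_plus (V := R_NormedModule)); apply is_derive_pow; eassumption.
  - real_components. ring. }
split; evar_last.
- apply is_derive_div; [exact G1|exact N|]. now rewrite set_coord_id.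
- real_components. field. intros E; apply HN; rewrite <- E; ring.
- apply is_derive_div; [|exact N|now rewrite set_coord_id].
  apply (is_derive_opp (V := R_NormedModule)). exact G2.
- real_components. field.
  intros E; apply HN; rewrite <- E; ring.
Qed.

Lemma is_pd_const k (c : C) P : is_pdC k (fun _ => c) P (RtoC 0).
Proof. exact (is_derive_const (K := R_AbsRing) (V := C_R_NormedModule) c (coord k P)). Qed.

Lemma continuous_C_pair {U : UniformSpace} (f : U -> C) x :
  continuous (fun t => Re (f t)) x -> continuous (fun t => Im (f t)) x -> continuous f x.
Proof.
intros H1 H2. apply filterlim_locally. intros eps.
assert (L1 := proj1 (filterlim_locally _ _) H1 eps).
assert (L2 := proj1 (filterlim_locally _ _) H2 eps).
exact (filter_and _ _ L1 L2).
Qed.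

Lemma continuous_Re {U : UniformSpace} (f : U -> C) x :
  continuous f x -> continuous (fun t => Re (f t)) x.
Proof.
intros H. apply (continuous_comp f Re); [exact H|].
destruct (f x) as [a b]. apply (continuous_fst a b).
Qed.

Lemma continuous_Im {U : UniformSpace} (f : U -> C) x :
  continuous f x -> continuous (fun t => Im (f t)) x.
Proof.
intros H. apply (continuous_comp f Im); [exact H|].
destruct (f x) as [a b]. apply (continuous_snd a b).
Qed.

Lemma continuous_Cplus (f g : R3 -> C) P :
  continuous f P -> continuous g P -> continuous (fun Q => f Q + g Q)%C P.
Proof. exact (continuous_plus (V := C_R_NormedModule) f g P). Qed.

Lemma continuous_Cmult (f g : R3 -> C) P :
  continuous f P -> continuous g P -> continuous (fun Q => f Q * g Q)%C P.
Proof.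
intros Hf Hg.
assert (F1 := continuous_Re _ _ Hf). assert (F2 := continuous_Im _ _ Hf).
assert (G1 := continuous_Re _ _ Hg). assert (G2 := continuous_Im _ _ Hg).
apply continuous_C_pair.
- apply (continuous_minus (V := R_NormedModule)); now apply (continuous_mult (K := R_AbsRing)).
- apply (continuous_plus (V := R_NormedModule)); now apply (continuous_mult (K := R_AbsRing)).
Qed.

Lemma continuous_Cinv_comp (g : R3 -> C) P :
  g P <> 0%C -> continuous g P -> continuous (fun Q => / g Q)%C P.
Proof.
intros H0 Hg. assert (HN := C_norm2_neq_0 _ H0).
assert (G1 := continuous_Re _ _ Hg). assert (G2 := continuous_Im _ _ Hg).
assert (N : continuous (fun Q => / (Re (g Q) ^ 2 + Im (g Q) ^ 2)) P).
{ apply (continuous_comp (fun Q => Re (g Q) ^ 2 + Im (g Q) ^ 2) Rinv);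
    [|now apply continuous_Rinv].
  apply (continuous_plus (V := R_NormedModule)); simpl;
  repeat apply (continuous_mult (K := R_AbsRing)); trivial; apply continuous_const. }
apply continuous_C_pair; apply (continuous_mult (K := R_AbsRing)); trivial.
now apply (continuous_opp (V := R_NormedModule)).
Qed.

Open Scope C_scope.

(** * The classes C^n and antigradients *)

Section Regularity.

Variable G : R3 -> Prop.
Hypothesis G_open : open G.

Lemma class_C_continuous n g : class_C n G g -> forall P, G P -> continuous g P.
Proof. destruct n; intros [H _]; exact H. Qed.

Lemma class_C_is_pd n g :
  class_C (S n) G g -> forall k P, G P -> is_pdC k g P (pd k g P).
Proof. intros [_ H] k P HP. apply ex_pd_correct. now apply H. Qed.

Lemma class_C_pd n g : class_C (S n) G g -> forall k, class_C n G (pd k g).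
Proof. intros [_ H] k. apply H. Qed.

Lemma class_C_ext n : forall g h, (forall P, G P -> g P = h P) ->
  class_C n G g -> class_C n G h.
Proof.
induction n as [|n IH]; intros g h E Hg.
- split; [|exact I]. intros P HP.
  apply (continuous_ext_loc _ g); [|exact (class_C_continuous _ g Hg P HP)].
  generalize (G_open P HP). apply filter_imp. exact E.
- split.
  + intros P HP. apply (continuous_ext_loc _ g); [|exact (class_C_continuous _ g Hg P HP)].
    generalize (G_open P HP). apply filter_imp. exact E.
  + assert (K : forall k P, G P -> is_pdC k h P (pd k g P)).
    { intros k P HP. apply (is_pd_ext_open G k g h P _ G_open E HP).
      now apply (class_C_is_pd n). }
    intros k. split.
    * intros P HP. apply (is_pd_ex k h P _ (K k P HP)).
    * apply (IH (pd k g)); [|now apply class_C_pd].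
      intros P HP. symmetry. now apply is_pd_unique, K.
Qed.

(** A function is of class C^(n+1) as soon as some functions of class C^n are its
    partial derivatives on [G]. *)
Lemma class_C_intro n g (d : axis -> R3 -> C) :
  (forall P, G P -> continuous g P) ->
  (forall k P, G P -> is_pdC k g P (d k P)) ->
  (forall k, class_C n G (d k)) -> class_C (S n) G g.
Proof.
intros Hc Hd Hn. split; [exact Hc|]. intros k. split.
- intros P HP. apply (is_pd_ex k g P _ (Hd k P HP)).
- apply (class_C_ext n (d k)); [|apply Hn].
  intros P HP. symmetry. now apply is_pd_unique, Hd.
Qed.

Lemma class_C_pred n : forall g, class_C (S n) G g -> class_C n G g.
Proof.
induction n as [|n IH]; intros g Hg.
- split; [|exact I]. exact (class_C_continuous 1 g Hg).
- split; [exact (class_C_continuous (S (S n)) g Hg)|]. intros k. split.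
  + exact (proj1 (proj2 Hg k)).
  + exact (IH _ (class_C_pd (S n) g Hg k)).
Qed.

Lemma class_C_plus n : forall (g h : R3 -> C), class_C n G g -> class_C n G h ->
  class_C n G (fun P => g P + h P).
Proof.
induction n as [|n IH]; intros g h Hg Hh.
- split; [|exact I]. intros P HP. apply continuous_Cplus; [now apply Hg|exact (class_C_continuous _ h Hh P HP)].
- apply (class_C_intro n _ (fun k P => pd k g P + pd k h P)).
  + intros P HP. apply continuous_Cplus; [now apply Hg|exact (class_C_continuous _ h Hh P HP)].
  + intros k P HP. apply is_pd_plus; now apply (class_C_is_pd n).
  + intros k. apply IH; now apply class_C_pd.
Qed.

Lemma class_C_mult n : forall (g h : R3 -> C), class_C n G g -> class_C n G h ->
  class_C n G (fun P => g P * h P).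
Proof.
induction n as [|n IH]; intros g h Hg Hh.
- split; [|exact I]. intros P HP. apply continuous_Cmult; [now apply Hg|exact (class_C_continuous _ h Hh P HP)].
- apply (class_C_intro n _ (fun k P => pd k g P * h P + g P * pd k h P)).
  + intros P HP. apply continuous_Cmult; [now apply Hg|exact (class_C_continuous _ h Hh P HP)].
  + intros k P HP. apply is_pd_mult; now apply (class_C_is_pd n).
  + intros k. apply class_C_plus; apply IH; first [now apply class_C_pd|now apply class_C_pred].
Qed.

Lemma class_C_const n : forall c : C, class_C n G (fun _ => c).
Proof.
induction n as [|n IH]; intros c.
- split; [|exact I]. intros P _. apply continuous_const.
- apply (class_C_intro n _ (fun _ _ => 0)).
  + intros P _. apply continuous_const.
  + intros k P _. apply is_pd_const.
  + intros _. apply IH.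
Qed.

Lemma class_C_inv n : forall (g : R3 -> C), (forall P, G P -> g P <> 0) -> class_C n G g ->
  class_C n G (fun P => / g P).
Proof.
induction n as [|n IH]; intros g H0 Hg.
- split; [|exact I]. intros P HP. apply continuous_Cinv_comp; [now apply H0|exact (class_C_continuous _ g Hg P HP)].
- apply (class_C_intro n _ (fun k P => - pd k g P * (/ g P * / g P))).
  + intros P HP. apply continuous_Cinv_comp; [now apply H0|exact (class_C_continuous _ g Hg P HP)].
  + intros k P HP. apply is_pd_inv; [now apply H0|]. now apply (class_C_is_pd n).
  + intros k. apply class_C_mult.
    * apply (class_C_ext n (fun P => - (1) * pd k g P)); [intros; ring|].
      apply class_C_mult; [apply class_C_const|now apply class_C_pd].
    * assert (K : class_C n G (fun P => / g P)) by (apply IH; trivial; now apply class_C_pred).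
      now apply class_C_mult.
Qed.

(** Continuity of [phi] itself is a consequence of that of its gradient. *)
Lemma class_C_of_gradient n (phi : R3 -> C) (e : axis -> R3 -> C) :
  (forall k P, G P -> is_pdC k phi P (e k P)) ->
  (forall k, class_C n G (e k)) -> class_C (S n) G phi.
Proof.
intros Hd He. apply (class_C_intro n phi e); trivial.
intros P HP. apply continuous_C_pair.
- apply (continuous_of_partials G _ (fun k Q => Re (e k Q))); trivial.
  + intros k Q HQ. now apply (is_pd_C k phi Q), Hd.
  + intros k Q HQ. apply continuous_Re. now apply (class_C_continuous n (e k)).
- apply (continuous_of_partials G _ (fun k Q => Im (e k Q))); trivial.
  + intros k Q HQ. now apply (is_pd_C k phi Q), Hd.
  + intros k Q HQ. apply continuous_Im. now apply (class_C_continuous n (e k)).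
Qed.

Lemma antigradient_exists (E : R3 -> HC) :
  simply_connected_domain G -> Hclass_C 1 G E ->
  (forall P, G P -> vectorial (E P)) ->
  (forall P, G P -> rot E P = Hzero) ->
  exists phi, antigradient G E phi.
Proof.
intros Hsc [_ [H1 [H2 H3]]] Hvec Hrot.
set (e1 := fun P => q1 (E P)) in *. set (e2 := fun P => q2 (E P)) in *.
set (e3 := fun P => q3 (E P)) in *.
assert (curl : forall P, G P -> pd axX e2 P = pd axY e1 P /\
  pd axX e3 P = pd axZ e1 P /\ pd axY e3 P = pd axZ e2 P).
{ intros P HP. assert (R := Hrot P HP).
  assert (sub0 : forall a b : C, a - b = 0 -> a = b).
  { intros a b Hab. replace a with (a - b + b) by ring. rewrite Hab. ring. }
  split; [|split].
  - apply sub0. exact (f_equal q3 R).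
  - symmetry. apply sub0. exact (f_equal q2 R).
  - apply sub0. exact (f_equal q1 R). }
assert (D12 : forall P, G P -> is_pdC axY e1 P (pd axY e1 P) /\ is_pdC axX e2 P (pd axY e1 P)).
{ intros P HP. split; [|rewrite <- (proj1 (curl P HP))]; now apply (class_C_is_pd 0). }
assert (D13 : forall P, G P -> is_pdC axZ e1 P (pd axZ e1 P) /\ is_pdC axX e3 P (pd axZ e1 P)).
{ intros P HP. split; [|rewrite <- (proj1 (proj2 (curl P HP)))]; now apply (class_C_is_pd 0). }
assert (D23 : forall P, G P -> is_pdC axZ e2 P (pd axZ e2 P) /\ is_pdC axY e3 P (pd axZ e2 P)).
{ intros P HP. split; [|rewrite <- (proj2 (proj2 (curl P HP)))]; now apply (class_C_is_pd 0). }
assert (Cpd : forall k e, class_C 1 G e -> forall P, G P -> continuous (pd k e) P).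
{ intros k e He. apply (class_C_continuous 0). now apply class_C_pd. }
assert (part : forall pr : C -> R,
  (forall (f : R3 -> C) P, continuous f P -> continuous (fun Q => pr (f Q)) P) ->
  (forall k f P l, is_pdC k f P l -> is_pd k (fun Q => pr (f Q)) P (pr l)) ->
  exists phi : R3 -> R, forall P, G P -> is_pd axX phi P (pr (e1 P)) /\
    is_pd axY phi P (pr (e2 P)) /\ is_pd axZ phi P (pr (e3 P))).
{ intros pr Hc Hd.
  apply (poincare_lemma G (fun P => pr (e1 P)) (fun P => pr (e2 P)) (fun P => pr (e3 P))
    (fun P => pr (pd axY e1 P)) (fun P => pr (pd axZ e1 P)) (fun P => pr (pd axZ e2 P)));
    trivial; intros P HP.
  - split; [|split]; apply Hc; now apply (class_C_continuous 1).
  - split; [|split]; apply Hc; now apply Cpd.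
  - split; apply Hd; now apply D12.
  - split; apply Hd; now apply D13.
  - split; apply Hd; now apply D23. }
destruct (part Re) as [phi1 P1].
{ intros. now apply continuous_Re. }
{ intros k f P l H. now apply is_pd_C in H. }
destruct (part Im) as [phi2 P2].
{ intros. now apply continuous_Im. }
{ intros k f P l H. now apply is_pd_C in H. }
exists (fun P => (phi1 P, phi2 P)). intros P HP.
destruct (P1 P HP) as [X1 [Y1 Z1]]. destruct (P2 P HP) as [X2 [Y2 Z2]].
assert (X : is_pdC axX (fun P => (phi1 P, phi2 P)) P (e1 P)) by (apply is_pd_C; now split).
assert (Y : is_pdC axY (fun P => (phi1 P, phi2 P)) P (e2 P)) by (apply is_pd_C; now split).
assert (Z : is_pdC axZ (fun P => (phi1 P, phi2 P)) P (e3 P)) by (apply is_pd_C; now split).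
split.
- intros []; eapply is_pd_ex; eassumption.
- unfold grad. rewrite (is_pd_unique _ _ _ _ X), (is_pd_unique _ _ _ _ Y),
    (is_pd_unique _ _ _ _ Z).
  rewrite <- (Hvec P HP). unfold e1, e2, e3. now destruct (E P).
Qed.

End Regularity.

(** * The equation for F in components *)

(** The component of the vector part in the direction [k]. *)
Definition vec (k : axis) (A : HC) : C :=
  match k with axX => q1 A | axY => q2 A | axZ => q3 A end.

Lemma pd_const k (c : C) P : pd k (fun _ => c) P = 0.
Proof. apply is_pd_unique, is_pd_const. Qed.

Lemma Czero_multiple (c a b : C) : b = 0 -> a = c * b -> a = 0.
Proof. intros -> ->. ring. Qed.

(** Scalar and vector part of [D F + F (Df / f) = 0], multiplied by [f] up to
    sign. *)
Lemma vekua_components (G : R3 -> Prop) (f : R3 -> C) (F : R3 -> HC) P :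
  open G -> G P -> f P <> 0 -> (forall Q, G Q -> vectorial (F Q)) ->
  Hadd (Dop F P) (Mright (Hscal (/ f P) (Dop (fun P => scalar (f P)) P)) (F P)) = Hzero ->
  f P * div F P
    + (pd axX f P * q1 (F P) + pd axY f P * q2 (F P) + pd axZ f P * q3 (F P)) = 0 /\
  f P * q1 (rot F P) = pd axY f P * q3 (F P) - pd axZ f P * q2 (F P) /\
  f P * q2 (rot F P) = pd axZ f P * q1 (F P) - pd axX f P * q3 (F P) /\
  f P * q3 (rot F P) = pd axX f P * q2 (F P) - pd axY f P * q1 (F P).
Proof.
intros HG HP Hf Hvec H.
assert (F0 : q0 (F P) = 0) by now apply Hvec.
assert (dF0 : forall k, pd k (fun Q => q0 (F Q)) P = 0).
{ intros k. apply is_pd_unique.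
  apply (is_pd_ext_open G k (fun _ => RtoC 0)); trivial; [|apply is_pd_const].
  intros Q HQ. symmetry. now apply Hvec. }
assert (E0 := f_equal q0 H). assert (E1 := f_equal q1 H).
assert (E2 := f_equal q2 H). assert (E3 := f_equal q3 H). clear H.
cbn [q0 q1 q2 q3 Hadd Hmul Mright Hscal Dop Hpd Hi Hj Hk scalar Hzero] in E0, E1, E2, E3.
change (fun Q => f Q) with f in E0, E1, E2, E3.
rewrite !pd_const, !dF0, F0 in E0, E1, E2, E3.
unfold div, rot. cbn [q1 q2 q3].
split; [|split; [|split]].
- apply (Czero_multiple (- f P) _ _ E0). now field.
- apply Ceq_minus. apply (Czero_multiple (f P) _ _ E1). now field.
- apply Ceq_minus. apply (Czero_multiple (f P) _ _ E2). now field.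
- apply Ceq_minus. apply (Czero_multiple (f P) _ _ E3). now field.
Qed.

Lemma is_pd_quotient k (f g : R3 -> C) P :
  f P <> 0 -> ex_pd k f P -> ex_pd k g P ->
  is_pdC k (fun Q => / f Q * g Q) P
    (- pd k f P * (/ f P * / f P) * g P + / f P * pd k g P).
Proof.
intros Hf Df Dg.
apply (is_pd_mult k (fun Q => / f Q) g).
- apply is_pd_inv; [exact Hf|now apply ex_pd_correct].
- now apply ex_pd_correct.
Qed.

Lemma rot_quotient_zero (G : R3 -> Prop) (f : R3 -> C) (F : R3 -> HC) P :
  open G -> G P -> (forall Q, G Q -> f Q <> 0) ->
  class_C 1 G f -> Hclass_C 1 G F -> (forall Q, G Q -> vectorial (F Q)) ->
  Hadd (Dop F P) (Mright (Hscal (/ f P) (Dop (fun P => scalar (f P)) P)) (F P)) = Hzero ->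
  rot (fun Q => Hscal (/ f Q) (F Q)) P = Hzero.
Proof.
intros HG HP Hf Cf [_ [C1 [C2 C3]]] Hvec H.
destruct (vekua_components G f F P HG HP (Hf P HP) Hvec H) as [_ [R1 [R2 R3]]].
unfold rot in *. cbn [q1 q2 q3 Hscal] in *.
assert (K : forall k g, class_C 1 G g -> pd k (fun Q => / f Q * g Q) P =
  - pd k f P * (/ f P * / f P) * g P + / f P * pd k g P).
{ intros k g Cg. apply is_pd_unique. apply is_pd_quotient; [now apply Hf| |].
  - now apply (proj2 Cf).
  - now apply (proj2 Cg). }
rewrite !(K _ (fun Q => q1 (F Q))), !(K _ (fun Q => q2 (F Q))),
  !(K _ (fun Q => q3 (F Q))) by assumption.
apply Ceq_minus in R1. apply Ceq_minus in R2. apply Ceq_minus in R3.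
unfold Hzero. f_equal.
- apply (Czero_multiple (/ f P * / f P) _ _ R1). field. now apply Hf.
- apply (Czero_multiple (/ f P * / f P) _ _ R2). field. now apply Hf.
- apply (Czero_multiple (/ f P * / f P) _ _ R3). field. now apply Hf.
Qed.

Lemma antigradient_is_pd G E phi k P :
  antigradient G E phi -> G P -> is_pdC k phi P (vec k (E P)).
Proof.
intros H HP. destruct (H P HP) as [Hex Hg]. rewrite <- Hg.
destruct k; apply ex_pd_correct, Hex.
Qed.

(** * The solution generated by an antigradient *)

(** Here [s] is a square root of [p], and the hypothesis on [div F] is the scalar
    part of the equation for [F], with [f = s u0]. *)
Lemma antigradient_solution (G : R3 -> Prop) (p q s u0 : R3 -> C) (F : R3 -> HC)
    (phi : R3 -> C) :
  open G -> class_C 2 G p -> class_C 2 G s ->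
  (forall P, G P -> s P <> 0) ->
  (forall P, G P -> s P * s P = p P) ->
  solution G p q u0 -> (forall P, G P -> u0 P <> 0) ->
  Hclass_C 1 G F ->
  (forall P, G P ->
     s P * u0 P * div F P
     + (pd axX (fun Q => s Q * u0 Q) P * q1 (F P)
        + pd axY (fun Q => s Q * u0 Q) P * q2 (F P)
        + pd axZ (fun Q => s Q * u0 Q) P * q3 (F P)) = 0) ->
  antigradient G (fun P => Hscal (/ (s P * u0 P)) (F P)) phi ->
  solution G p q (fun P => u0 P * phi P).
Proof.
intros HG Cp Cs Hs Hss [Cu0 Hu0] Hu CF Hdiv Hphi.
assert (Hf : forall P, G P -> s P * u0 P <> 0)
  by (intros P HP; apply Cmult_neq_0; [now apply Hs|now apply Hu]).
assert (Dphi : forall k P, G P -> is_pdC k phi P (/ (s P * u0 P) * vec k (F P))).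
{ intros k P HP. assert (K := antigradient_is_pd G _ phi k P Hphi HP).
  now destruct k. }
assert (CFk : forall k, class_C 1 G (fun P => vec k (F P)))
  by (destruct CF as [_ [? [? ?]]]; now intros []).
assert (Cf : class_C 1 G (fun P => / (s P * u0 P))).
{ apply (class_C_inv G HG 1 (fun P => s P * u0 P) Hf).
  apply (class_C_mult G HG 1); now apply (class_C_pred G 1). }
assert (Cphi : class_C 2 G phi).
{ apply (class_C_of_gradient G HG 1 phi _ Dphi). intros k.
  now apply (class_C_mult G HG 1 (fun P => / (s P * u0 P))). }
split; [now apply (class_C_mult G HG 2)|].
intros P HP.
(* p grad u = phi p grad u0 + s F *)
assert (flux : forall k Q, G Q ->
  p Q * pd k u0 Q * phi Q + s Q * vec k (F Q) = p Q * pd k (fun P => u0 P * phi P) Q).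
{ intros k Q HQ.
  rewrite (is_pd_unique k (fun P => u0 P * phi P) Q _
    (is_pd_mult k u0 phi Q _ _ (class_C_is_pd G 1 u0 Cu0 k Q HQ) (Dphi k Q HQ))).
  rewrite <- (Hss Q HQ). field. split; [now apply Hu|now apply Hs]. }
assert (Cpu : forall k, class_C 1 G (fun Q => p Q * pd k u0 Q)).
{ intros k. apply (class_C_mult G HG 1); [now apply (class_C_pred G 1)|].
  now apply (class_C_pd G 1). }
assert (dflux : forall k, pd k (fun Q => p Q * pd k (fun P => u0 P * phi P) Q) P =
  (pd k (fun Q => p Q * pd k u0 Q) P * phi P
   + p P * pd k u0 P * (/ (s P * u0 P) * vec k (F P)))
  + (pd k s P * vec k (F P) + s P * pd k (fun Q => vec k (F Q)) P)).
{ intros k. apply is_pd_unique. apply (is_pd_ext_open G k _ _ P _ HG (flux k) HP).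
  apply is_pd_plus.
  - apply (is_pd_mult k (fun Q => p Q * pd k u0 Q)); [|now apply Dphi].
    now apply (class_C_is_pd G 0).
  - apply is_pd_mult; [now apply (class_C_is_pd G 1)|now apply (class_C_is_pd G 0 _ (CFk k))]. }
assert (Df : forall k, pd k (fun Q => s Q * u0 Q) P = pd k s P * u0 P + s P * pd k u0 P).
{ intros k. apply is_pd_unique, is_pd_mult; now apply (class_C_is_pd G 1). }
assert (Ediv := Hdiv P HP). rewrite !Df in Ediv.
assert (Eu := Hu0 P HP).
assert (DX := dflux axX). assert (DY := dflux axY). assert (DZ := dflux axZ).
unfold div in *. cbn [q1 q2 q3 Hscal grad vec] in *.
rewrite DX, DY, DZ, <- (Hss P HP).
assert (Hu0P := Hu P HP). assert (HsP := Hs P HP).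
set (X0 := pd axX (fun Q => p Q * pd axX u0 Q) P) in *.
set (Y0 := pd axY (fun Q => p Q * pd axY u0 Q) P) in *.
set (Z0 := pd axZ (fun Q => p Q * pd axZ u0 Q) P) in *.
(* the equation for [u0] is used to eliminate one second derivative *)
assert (EX : X0 = - Y0 - Z0 - q P * u0 P).
{ apply Ceq_minus. apply (Czero_multiple 1 _ _ Eu). ring. }
rewrite EX.
apply (Czero_multiple (/ u0 P) _ _ Ediv). field. now split.
Qed.

Theorem theorem46 :
  forall (G : R3 -> Prop) (p q sqrt_p u0 : R3 -> C) (F : R3 -> HC),
  simply_connected_domain G ->
  class_C 2 G p ->
  (forall P, G P -> p P <> 0) ->
  class_C 2 G sqrt_p ->
  (forall P, G P -> sqrt_p P * sqrt_p P = p P) ->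
  solution G p q u0 ->
  (forall P, G P -> u0 P <> 0) ->
  let f := fun P => sqrt_p P * u0 P in
  Hclass_C 1 G F ->
  (forall P, G P -> vectorial (F P)) ->
  (forall P, G P ->
     Hadd (Dop F P) (Mright (Hscal (/ f P) (Dop (fun P => scalar (f P)) P)) (F P))
     = Hzero) ->
  let E := fun P => Hscal (/ f P) (F P) in
  Hclass_C 1 G E /\
  (forall P, G P -> rot E P = Hzero) /\
  (exists phi : R3 -> C, antigradient G E phi) /\
  (forall phi : R3 -> C, antigradient G E phi ->
     solution G p q (fun P => u0 P * phi P)).
Proof.
intros G p q s u0 F Hsc Cp Hp Cs Hss Hu0 Hu f CF Hvec HF E.
assert (HG : open G) by apply Hsc.
assert (Hs : forall P, G P -> s P <> 0).
{ intros P HP E0. apply (Hp P HP). rewrite <- (Hss P HP), E0. ring. }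
assert (Hf : forall P, G P -> f P <> 0)
  by (intros P HP; apply Cmult_neq_0; [now apply Hs|now apply Hu]).
assert (Cf : class_C 1 G f).
{ apply (class_C_mult G HG 1); apply (class_C_pred G 1); [exact Cs|apply Hu0]. }
assert (CE : Hclass_C 1 G E).
{ destruct CF as [? [? [? ?]]].
  assert (Ci := class_C_inv G HG 1 f Hf Cf).
  split; [|split; [|split]]; now apply (class_C_mult G HG 1 (fun P => / f P)). }
assert (RE : forall P, G P -> rot E P = Hzero).
{ intros P HP. now apply (rot_quotient_zero G); [| | | | | |apply HF]. }
split; [exact CE|split; [exact RE|split]].
- apply (antigradient_exists G HG E Hsc CE); [|exact RE].
  intros P HP. unfold vectorial, E. cbn [q0 Hscal]. rewrite (Hvec P HP). ring.
- intros phi Hphi. apply (antigradient_solution G p q s u0 F); trivial.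
  intros P HP.
  exact (proj1 (vekua_components G f F P HG HP (Hf P HP) Hvec (HF P HP))).
Qed.
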